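(* Let $K$ be an algebraically closed field of characteristic zero, let $R$ be a normal quantum solvable algebra (NQS-algebra) over $C$ obeying Conditions CN1 and CN2, and let $\varepsilon$ be an admissible root of unity for $R$ (a primitive $l$-th root of unity with $l$ admissible) at which $C$ can be specialised. Let $\chi:Z_\varepsilon\to K$ be a central character and $R_{\varepsilon,\chi}=R_\varepsilon/m(\chi)R_\varepsilon$, $m(\chi)=\ker\chi$. Then any two vertices $e_i,e_j$, $i\ne j$, of the quiver of the algebra $R_{\varepsilon,\chi}$ are linked by the edges $(e_i,e_j)$ and $(e_j,e_i)$. In particular, the quiver is connected.
   Context: Ground ring. $q$ is an indeterminate, $C$ a localization of $K[q,q^{-1}]$ at a finitely generated multiplicative set. A skew extension $A[x;\tau,\delta]$ ($\tau$ an automorphism, $\delta$ a $\tau$-derivation: $\delta(ab)=\delta(a)b+\tau(a)\delta(b)$) is generated by $A$ and $x$ with $xa=\tau(a)x+\delta(a)$, and its elements are uniquely of the form $\sum r_ix^i$, $r_i\in A$. NQS-algebra. Let $\mathbb S=(s_{ij})$ be an $M\times M$ integer skew-symmetric matrix, $q_{ij}=q^{s_{ij}}$, and $\kappa\subset\{1,\dots,M\}$ a (distinguished) subset. A $C$-algebra $R$ ($C$ central) is an NQS-algebra if it is generated over $C$ by $x_1,\dots,x_M$ and $x_j^{-1}$ ($j\in\kappa$); the monomials $x_1^{t_1}\cdots x_M^{t_M}$ ($t_j\in\mathbb Z$ for $j\in\kappa$, $t_j\in\mathbb N$ for $j\notin\kappa$) form a free $C$-basis; $x_ix_j=q_{ij}x_jx_i$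 for all $i$ and all $j\in\kappa$; and for $i<j$, $x_ix_j=q_{ij}x_jx_i+r_{ij}$ with $r_{ij}$ a sum of monomials $c\,x_{i+1}^{t_{i+1}}\cdots x_{j-1}^{t_{j-1}}$, $c\in C$. Let $R_i$ (resp. $R'_i$) be the subalgebra generated by $C$, the $x_j$ with $j\ge i$ (resp. $j\le i$) and their inverses for $j\in\kappa$. Then $R_i=R_{i+1}[x_i;\tau_i,\delta_i]$ and $R'_i=R'_{i-1}[x_i;\tau'_i,\delta'_i]$ (with $x_i$ inverted and $\delta_i=\delta'_i=0$ if $i\in\kappa$), where $\tau_i(x_j)=q_{ij}x_j$, $\delta_i(x_j)=r_{ij}$ for $j>i$, and $\tau_i'(x_j)=q_{ij}x_j$ for $j<i$. Condition CN1: $\tau_i\delta_i=q^{s_i}\delta_i\tau_i$ and $\tau'_i\delta'_i=q^{s'_i}\delta'_i\tau'_i$ for some integers $s_i,s_i'$, with $s_i\ne0$ if $\delta_i\neq0$ and $s'_i\ne0$ if $\delta'_i\ne0$. Condition CN2: all $\tau_i$ and $\tau_i'$ extend to diagonal automorphisms of $R$ (every $x_j$ is an eigenvector) and generate commutative diagonal groups $H$ and $H'$. $N_\alpha$ is a positive integer with $\delta_\alpha^{N_\alpha}(x_j)=0$ for $j>\alpha$ and $(\delta'_\alpha)^{N_\alpha}(x_j)=0$ for $j<\alpha$; $N=\max_\alpha N_\alpha$. Admissibility. $l$ is admissible for $R$ if: 1) $l$ is relatively prime with all (nonzero) elementary divisors of all submatrices $\mathbb S_\mu=(s_{ij})_{i,j\in\mu}$,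 $\kappa\subset\mu\subset\{1,\dots,M\}$; 2) $l$ is relatively prime with all $s_i,s_i'$, $1\le i\le M$; 3) $l\ge N$. Specialisation. $R_\varepsilon=R/(q-\varepsilon)R$, $Z_\varepsilon$ is the center of $R_\varepsilon$ ($R_\varepsilon$ is finite over $Z_\varepsilon$, so $R_{\varepsilon,\chi}$ is finite dimensional). Quiver. For a finite dimensional algebra $A$ with radical $J$, the vertices of its quiver are primitive idempotents $e_1,\dots,e_n$ such that the right ideals $e_1A,\dots,e_nA$ represent the isomorphism classes of principal indecomposable $A$-modules, each class once. Vertices $e_i,e_j$ are linked by an edge $(e_i,e_j)$ if $e_iJe_j\ne0$. *)

(* Defs.v *)
From HB Require Import structures.
From mathcomp Require Import all_boot all_order all_algebra.
From Stdlib Require Export Relation_Operators.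

Set Implicit Arguments.
Unset Strict Implicit.
Unset Printing Implicit Defensive.

Import Order.TTheory GRing.Theory Num.Theory.
Local Open Scope ring_scope.

Inductive mulset (K : comNzRingType) (fs : seq K) : K -> Prop :=
| mulset1 : mulset fs 1
| mulsetM f s : f \in fs -> mulset fs s -> mulset fs (f * s).

Definition is_localization (P C : comNzRingType) (iota : {rmorphism P -> C})
    (S : P -> Prop) : Prop :=
  [/\ forall s, S s -> exists c, iota s * c = 1,
      forall c, exists p s, S s /\ c * iota s = iota p
    & forall p, iota p = 0 -> exists2 s, S s & s * p = 0].

(* The variable of {poly K} plays the role of q.  Up to powers of q, every
   finitely generated multiplicative subset of K[q, q^-1] is generated by q and
   finitely many polynomials fs, so the localizations of K[q, q^-1] at finitely
   generated multiplicative sets are those of K[q] at mulset ('X :: fs). *)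
Definition ground_ring (K : fieldType) (C : comNzRingType)
    (iota : {rmorphism {poly K} -> C}) : Prop :=
  exists fs : seq {poly K}, is_localization iota (mulset ('X :: fs)).

Section NQS.

Variables (C : comUnitRingType) (q : C) (R : unitAlgType C) (M : nat).
Variables (S : 'M[int]_M) (kappa : {set 'I_M}) (x : 'I_M -> R).

Definition qq (i j : 'I_M) : C := q ^ S i j.

Definition expo := {ffun 'I_M -> int}.

(* Negative exponents are only allowed on the distinguished generators. *)
Definition admissible_expo (t : expo) : bool :=
  [forall j, (j \notin kappa) ==> (0 <= t j)].

(* The product is non commutative and taken in increasing order of indices. *)
Definition monomial (t : expo) : R := \prod_(j < M) x j ^ t j.

Definition in_span (P : pred expo) (a : R) : Prop :=
  exists (ts : seq expo) (c : expo -> C),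
    all P ts /\ a = \sum_(t <- ts) c t *: monomial t.

Definition monomials_free : Prop :=
  forall (ts : seq expo) (c : expo -> C), uniq ts -> all admissible_expo ts ->
    \sum_(t <- ts) c t *: monomial t = 0 -> forall t, t \in ts -> c t = 0.

Definition expo_between (i j : 'I_M) (t : expo) : bool :=
  admissible_expo t && [forall k : 'I_M, (t k != 0) ==> (i < k < j)%N].

Inductive subalg (P : pred 'I_M) : R -> Prop :=
| subalg_scalar (c : C) : subalg P c%:A
| subalg_gen j : P j -> subalg P (x j)
| subalg_inv j : P j -> j \in kappa -> subalg P (x j)^-1
| subalg_add a b : subalg P a -> subalg P b -> subalg P (a + b)
| subalg_mul a b : subalg P a -> subalg P b -> subalg P (a * b).

Record is_NQS (r : 'I_M -> 'I_M -> R) : Prop := IsNQS {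
  nqs_skew : S^T = - S;
  nqs_unit : forall j, j \in kappa -> x j \is a GRing.unit;
  nqs_generated : forall a, subalg xpredT a;
  nqs_spanning : forall a, in_span admissible_expo a;
  nqs_free : monomials_free;
  nqs_qcomm : forall i j, j \in kappa -> x i * x j = qq i j *: (x j * x i);
  nqs_rel : forall i j : 'I_M, (i < j)%N ->
    x i * x j = qq i j *: (x j * x i) + r i j;
  nqs_rest : forall i j : 'I_M, (i < j)%N -> in_span (expo_between i j) (r i j)
}.

(* Everything takes place inside R: A and B are subrings of R, and the maps
   tau and delta are only meaningful on A.  If inv holds, the extension is
   A[z^{+-1}; tau] with delta = 0; otherwise it is A[z; tau, delta]. *)
Record skew_extension (inv : bool) (A B : R -> Prop) (z : R)
    (tau delta : R -> R) : Prop := SkewExtension {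
  skew_tau_in : forall a, A a -> A (tau a);
  skew_tau1 : tau 1 = 1;
  skew_tauD : forall a b, A a -> A b -> tau (a + b) = tau a + tau b;
  skew_tauM : forall a b, A a -> A b -> tau (a * b) = tau a * tau b;
  skew_tau_inj : forall a b, A a -> A b -> tau a = tau b -> a = b;
  skew_tau_surj : forall b, A b -> exists2 a, A a & tau a = b;
  skew_delta_in : forall a, A a -> A (delta a);
  skew_deltaD : forall a b, A a -> A b -> delta (a + b) = delta a + delta b;
  skew_deltaM : forall a b, A a -> A b ->
    delta (a * b) = delta a * b + tau a * delta b;
  skew_delta0 : inv -> forall a, A a -> delta a = 0;
  skew_rel : forall a, A a -> z * a = tau a * z + delta a;
  skew_elements : forall b, B b <->
    exists (ks : seq int) (c : int -> R),
      [/\ all (fun k => inv || (0 <= k)) ks, forall k, A (c k)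
        & b = \sum_(k <- ks) c k * z ^ k];
  skew_unique : forall (ks : seq int) (c : int -> R),
    uniq ks -> all (fun k => inv || (0 <= k)) ks -> (forall k, A (c k)) ->
    \sum_(k <- ks) c k * z ^ k = 0 -> forall k, k \in ks -> c k = 0
}.

Definition ge_alg (i : 'I_M) := subalg (fun j => (i <= j)%N).
Definition gt_alg (i : 'I_M) := subalg (fun j => (i < j)%N).
Definition le_alg (i : 'I_M) := subalg (fun j => (j <= i)%N).
Definition lt_alg (i : 'I_M) := subalg (fun j => (j < i)%N).

Definition left_skew_data (r : 'I_M -> 'I_M -> R)
    (tau delta : 'I_M -> R -> R) : Prop :=
  forall i : 'I_M,
    [/\ skew_extension (i \in kappa) (gt_alg i) (ge_alg i) (x i)
          (tau i) (delta i),
        forall j : 'I_M, (i < j)%N -> tau i (x j) = qq i j *: x j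
      & forall j : 'I_M, (i < j)%N -> delta i (x j) = r i j].

Definition right_skew_data (tau' delta' : 'I_M -> R -> R) : Prop :=
  forall i : 'I_M,
    skew_extension (i \in kappa) (lt_alg i) (le_alg i) (x i)
      (tau' i) (delta' i)
    /\ forall j : 'I_M, (j < i)%N -> tau' i (x j) = qq i j *: x j.

Definition CN1_at (A : R -> Prop) (tau delta : R -> R) (s : int) : Prop :=
  (forall a, A a -> tau (delta a) = (q ^ s) *: delta (tau a))
  /\ ((exists2 a, A a & delta a <> 0) -> s <> 0).

Definition CN1 (tau delta tau' delta' : 'I_M -> R -> R)
    (s s' : 'I_M -> int) : Prop :=
  forall i, CN1_at (gt_alg i) (tau i) (delta i) (s i)
         /\ CN1_at (lt_alg i) (tau' i) (delta' i) (s' i).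

Definition diagonal (f : R -> R) : Prop :=
  forall j, exists c : C, f (x j) = c *: x j.

Inductive gen_group (T : 'I_M -> R -> R) : (R -> R) -> Prop :=
| gen_group_id : gen_group T idfun
| gen_group_gen i : gen_group T (T i)
| gen_group_comp f g : gen_group T f -> gen_group T g -> gen_group T (f \o g)
| gen_group_inv f g : gen_group T f -> cancel f g -> cancel g f ->
    gen_group T g.

Definition extends_diagonally (A : 'I_M -> R -> Prop)
    (tau : 'I_M -> R -> R) : Prop :=
  exists T : 'I_M -> {lrmorphism R -> R},
    [/\ forall i, bijective (T i),
        forall i a, A i a -> T i a = tau i a,
        forall f, gen_group T f -> diagonal f
      & forall f g, gen_group T f -> gen_group T g -> f \o g =1 g \o f].

Definition CN2 (tau tau' : 'I_M -> R -> R) : Prop :=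
  extends_diagonally gt_alg tau /\ extends_diagonally lt_alg tau'.

Definition nilpotency_bounds (delta delta' : 'I_M -> R -> R)
    (Nb : 'I_M -> nat) : Prop :=
  forall i : 'I_M,
    [/\ (0 < Nb i)%N,
        forall j : 'I_M, (i < j)%N -> iter (Nb i) (delta i) (x j) = 0
      & forall j : 'I_M, (j < i)%N -> iter (Nb i) (delta' i) (x j) = 0].

End NQS.

(* The elementary divisors of an integer matrix are the nonzero diagonal
   entries of its Smith normal form (they are determined up to sign). *)
Definition elementary_divisor (m n : nat) (A : 'M[int]_(m, n)) (d : int) :
    Prop :=
  exists (L : 'M[int]_m) (U : 'M[int]_n) (ds : seq int),
    [/\ L \in unitmx, U \in unitmx, sorted dvdz ds,
        A = L *m (\matrix_(i, j) (ds`_i *+ (i == j :> nat))) *m U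
      & d != 0 /\ exists2 k, (k < minn m n)%N & d = ds`_k].

Definition principal_submx (M : nat) (S : 'M[int]_M) (mu : {set 'I_M}) :
    'M[int]_#|mu| :=
  mxsub enum_val enum_val S.

Definition admissible (M : nat) (S : 'M[int]_M) (kappa : {set 'I_M})
    (s s' : 'I_M -> int) (Nb : 'I_M -> nat) (l : nat) : Prop :=
  [/\ forall (mu : {set 'I_M}) (d : int), kappa \subset mu ->
        elementary_divisor (principal_submx S mu) d -> coprimez l d,
      forall i, coprimez l (s i) /\ coprimez l (s' i)
    & (\max_(i < M) Nb i <= l)%N].

Definition is_quotient (A B : nzRingType) (pi : {rmorphism A -> B})
    (I : A -> Prop) : Prop :=
  (forall b, exists a, pi a = b) /\ (forall a, pi a = 0 <-> I a).

(* The K-structure of R / (q - eps) R comes from C / (q - eps) C = K, that is,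
   from the evaluation ev at eps. *)
Definition is_specialization (K : fieldType) (C : comUnitRingType)
    (iota : {rmorphism {poly K} -> C}) (R : unitAlgType C) (eps : K)
    (ev : C -> K) (Re : algType K) (pi : {rmorphism R -> Re}) : Prop :=
  is_quotient pi (fun a => exists b : R, a = iota ('X - eps%:P) *: b)
  /\ (forall (c : C) (a : R), pi (c *: a) = ev c *: pi a).

Definition central (A : nzRingType) (z : A) : Prop := forall a, z * a = a * z.

(* Only the values of chi on the center matter. *)
Definition central_character (K : fieldType) (A : algType K) (chi : A -> K) :
    Prop :=
  [/\ chi 1 = 1,
      forall y z, central y -> central z -> chi (y + z) = chi y + chi z,
      forall y z, central y -> central z -> chi (y * z) = chi y * chi z
    & forall (k : K) z, central z -> chi (k *: z) = k * chi z].

(* The ideal m(chi) A generated by the kernel m(chi) of chi on the center. *)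
Definition character_ideal (K : fieldType) (A : algType K) (chi : A -> K)
    (a : A) : Prop :=
  exists (n : nat) (z b : 'I_n -> A),
    (forall i, central (z i) /\ chi (z i) = 0) /\ a = \sum_(i < n) z i * b i.

Section Quiver.

Variable A : nzRingType.

Definition right_ideal (I : A -> Prop) : Prop :=
  [/\ I 0, forall a b, I a -> I b -> I (a + b)
    & forall a b, I a -> I (a * b)].

Definition maximal_right_ideal (I : A -> Prop) : Prop :=
  [/\ right_ideal I, ~ I 1
    & forall J : A -> Prop, right_ideal J -> (forall a, I a -> J a) ->
        ~ J 1 -> forall a, J a -> I a].

Definition radical (a : A) : Prop :=
  forall I, maximal_right_ideal I -> I a.

Definition nonzero_ideal (I : A -> Prop) : Prop := exists2 a, I a & a <> 0.

Definition direct_sum (P I J : A -> Prop) : Prop :=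
  (forall a, P a <-> exists b c, [/\ I b, J c & a = b + c])
  /\ (forall a, I a -> J a -> a = 0).

(* The indecomposable direct summands of the right regular module. *)
Definition principal_indecomposable (P : A -> Prop) : Prop :=
  [/\ right_ideal P,
      exists2 Q, right_ideal Q & direct_sum (fun _ => True) P Q,
      nonzero_ideal P
    & forall I J, right_ideal I -> right_ideal J -> direct_sum P I J ->
        ~ (nonzero_ideal I /\ nonzero_ideal J)].

Definition right_isomorphic (I J : A -> Prop) : Prop :=
  exists phi : A -> A,
    [/\ forall a b, I a -> I b -> phi (a + b) = phi a + phi b,
        forall a b, I a -> phi (a * b) = phi a * b,
        forall a, I a -> J (phi a),
        forall a b, I a -> I b -> phi a = phi b -> a = b
      & forall b, J b -> exists2 a, I a & phi a = b].

Definition idempotent (e : A) : Prop := e * e = e.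

Definition primitive_idempotent (e : A) : Prop :=
  [/\ idempotent e, e <> 0
    & forall f g, idempotent f -> idempotent g -> f * g = 0 -> g * f = 0 ->
        e = f + g -> f = 0 \/ g = 0].

Definition right_multiples (e : A) (a : A) : Prop := exists b, a = e * b.

Definition quiver_vertices (n : nat) (e : 'I_n -> A) : Prop :=
  [/\ forall i, primitive_idempotent (e i),
      forall i, principal_indecomposable (right_multiples (e i)),
      forall i j,
        right_isomorphic (right_multiples (e i)) (right_multiples (e j)) ->
        i = j
    & forall P, principal_indecomposable P ->
        exists i, right_isomorphic P (right_multiples (e i))].

Definition quiver_edge (n : nat) (e : 'I_n -> A) (i j : 'I_n) : Prop :=
  exists2 a, radical a & e i * a * e j <> 0.

(* Any two vertices are joined by a path of edges, ignoring orientations. *)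
Definition quiver_connected (n : nat) (e : 'I_n -> A) : Prop :=
  forall i j, clos_refl_sym_trans _ (quiver_edge e) i j.

End Quiver.

(* Main.v *)
Require Import Defs.
From HB Require Import structures.
From mathcomp Require Import all_boot all_order all_algebra.
From mathcomp Require Import all_field boolp zify ring.

Set Implicit Arguments.
Unset Strict Implicit.
Unset Printing Implicit Defensive.

Import Order.TTheory GRing.Theory Num.Theory.
Local Open Scope ring_scope.

(** Let [Re] be the specialised algebra, [Z] its centre, [m] the kernel of
    [chi] on [Z] and [A = Re / m Re]. A homomorphism between two
    nonisomorphic indecomposable projective [A]-modules has its image in the
    radical ([nonzero_hom_radical]), so that [e i] and [e j] are joined by an
    edge as soon as [e i * c * e j <> 0] for some [c]. The theorem therefore
    says that idempotents [e, f] of the fibre [A] with [e * A * f = 0] satisfy [e = 0] or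
    [f = 0] ([fiber_idempotents_linked]). One reason is that the completion of
    [Re] at [m] is a prime ring, to which idempotents can be lifted; what makes
    it prime is that [Re] is a domain, finite over [Z], and that [Z] is
    integrally closed. Traces lead to the same conclusion without completing.

    Let [F] be the field of fractions of [Z] and [n] the dimension over [F] of
    the division ring of fractions of [Re]. In characteristic zero the trace
    form is nondegenerate, hence every [F]-linear form that vanishes on
    commutators is a multiple of the trace ([trace_unique]), and the operator
    [c |-> a * c * b] has trace [tr a * tr b / n] ([trace_lrmul]).
    Lift [e] and [f] to [a] and [b] in [Re]. Since [a * Re * b] lies in [m Re],
    the Cayley-Hamilton theorem provides a monic polynomial over [Z] that kills
    this operator and is a power of the variable modulo [m]
    ([annihilator_mod]). The characteristic polynomial of the operator has its
    coefficients in [Z], because [Z] is integrally closed, and divides a power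
    of that polynomial; hence the trace lies in [m]
    ([char_poly_reduction]). In the same way the trace of [a] reduces modulo
    [m] to the number of eigenvalues of [e] that are equal to 1, and this
    number is zero only if [a] lies in [m Re] ([idempotent_trace]). A product of
    two such integers is zero in [K], so that one of them is.

    Three properties of [Re] remain to be shown.
    - It is finite over [Z], because [x i ^ l] becomes central: the q-binomial
      coefficients in the expansion of [x i ^ l * a] vanish at a root of unity,
      and the last term does since [l] exceeds the order of nilpotency of the
      skew derivation on the generators ([power_commutes]).
    - It is a domain. The variables can be given weights for which the
      corrections [r i j] are of smaller weight than [x i * x j]
      ([wt_between]). Up to terms of smaller weight, and up to scalars,
      monomials are then multiplied by adding exponents ([leads_mul]), and
      leading terms are multiplicative ([leading_mul]).
    - Its centre is integrally closed ([center_integrally_closed]). The powers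
      of an integral element [f] of [F] have a common denominator [c], and
      [O = Re + Re f + ...] is an overring of [Re] with [c O] in [Re]. An
      element [y = c o] of [c O] satisfies [y ^ n \in c ^ (n - 1) Re] for every
      [n], and a comparison of leading exponents shows that the leading monomial
      of [y] is divisible by that of [c]. The division of [y] by [c] thus never
      gets stuck, and [c O = c Re] ([scaled_order_division]). As the exponents
      of the invertible variables are not bounded below, the division stops for
      a further reason: the same comparison, for the order that reverses one
      such exponent, bounds it from below throughout
      ([quotient_bound]). *)

(** * Characteristic polynomials over an integrally closed domain *)

Lemma irreducible_factor (F : fieldType) (p : {poly F}) :
  (1 < size p)%N -> exists2 g, irreducible_poly g & g %| p.
Proof.
have [n] := ubnP (size p); elim: n p => // n IHn p; rewrite ltnS => le_pn p_gt1.
have [irr_p|] := pselect (irreducible_poly p); first by exists p.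
move=> nirr; suff [q [q1 q_p qp]] : exists q : {poly F},
    [/\ size q != 1, q %| p & ~~ (q %= p)].
  have p0 : p != 0 by rewrite -size_poly_gt0 (ltn_trans _ p_gt1).
  have lt_qp : (size q < size p)%N.
    by rewrite ltn_neqAle dvdp_leq // andbT dvdp_size_eqp.
  have q_gt1 : (1 < size q)%N.
    have := size_poly_gt0 q.
    rewrite (contraNneq _ p0) => [|q0]; last by rewrite -dvd0p -q0.
    by case: (size q) q1 => [|[]].
  have [g irr_g g_q] := IHn q (leq_trans lt_qp le_pn) q_gt1.
  by exists g => //; apply: dvdp_trans q_p.
apply: contrapT => nex; apply: nirr; split=> // q q1 q_p.
by apply: contrapT => /negP nqp; apply: nex; exists q.
Qed.

(** One root is adjoined at a time, as a generator of the extension defined by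
    an irreducible factor. *)
Lemma splitting_extension (F : fieldType) (p : {poly F}) :
  p \is monic ->
  exists (E : fieldType) (f : {rmorphism F -> E}) (rs : seq E),
    map_poly f p = \prod_(r <- rs) ('X - r%:P).
Proof.
have [n] := ubnP (size p).
elim: n F p => // n IHn F p; rewrite ltnS => le_pn mon_p.
have [p_gt1|p_le1] := ltnP 1 (size p); last first.
  exists F, idfun, [::]; rewrite big_nil map_poly_id //.
  move: mon_p; rewrite (size1_polyC p_le1) monicE lead_coefC => /eqP->.
  by rewrite polyC1.
have [g irr_g g_p] := irreducible_factor p_gt1.
have [L _ [z gz _]] := irredp_FAdjoin irr_g.
have pz : root (map_poly (in_alg L) p) z.
  move: gz; rewrite -!dvdp_XsubCl => /dvdp_trans; apply.
  by rewrite dvdp_map.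
have [q def_q] := factor_theorem _ _ pz.
have mon_pL : map_poly (in_alg L) p \is monic by rewrite map_monic.
have mon_q : q \is monic by rewrite -(monicMr _ (monicXsubC z)) -def_q.
have lt_qn : (size q < n)%N.
  rewrite -(size_map_poly (in_alg L)) def_q in le_pn.
  by rewrite size_Mmonic ?monicXsubC ?monic_neq0 // size_XsubC addn2 in le_pn.
have [E [f [rs def_f]]] := IHn _ q lt_qn mon_q.
exists E, (f \o in_alg L), (f z :: rs).
rewrite map_poly_comp /= def_q rmorphM /= map_polyXsubC def_f.
by rewrite big_cons mulrC.
Qed.

Lemma integral_coef_prod_XsubC (Z : comNzRingType) (E : fieldType)
    (f : {rmorphism Z -> E}) (rs : seq E) :
  (forall r, r \in rs -> integralOver f r) ->
  forall i, integralOver f (\prod_(r <- rs) ('X - r%:P))`_i.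
Proof.
elim: rs => [_ i|r rs IHrs int_rs i].
  by rewrite big_nil coef1; apply: integral_nat.
have IH : forall i, integralOver f (\prod_(r <- rs) ('X - r%:P))`_i.
  by apply: IHrs => s rs_s; apply: int_rs; rewrite inE rs_s orbT.
rewrite big_cons mulrBl coefB coefXM mul_polyC coefZ.
apply: integral_sub; first by case: ifP => _ //; apply: integral0.
by apply: integral_mul => //; apply: int_rs; rewrite mem_head.
Qed.

Section MonicAnnihilator.

Variables (Z : idomainType) (F : fieldType) (j : {rmorphism Z -> F}).
Variables (D : nat) (A : 'M[F]_D.+1) (q : {poly Z}).
Hypotheses (mon_q : q \is monic) (qA : horner_mx A (map_poly j q) = 0).

Lemma char_poly_root_annihilator (E : fieldType) (f : {rmorphism F -> E}) r :
  root (map_poly f (char_poly A)) r -> root (map_poly (f \o j) q) r.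
Proof.
rewrite map_char_poly -root_mxminpoly map_poly_comp -!dvdp_XsubCl.
move=> /dvdp_trans; apply; apply: mxminpoly_min.
by rewrite -map_horner_mx qA map_mx0.
Qed.

(** The eigenvalues are roots of [q], hence integral, and the coefficients are
    polynomials in the eigenvalues. *)
Lemma integral_char_poly i : integralOver j (char_poly A)`_i.
Proof.
have [E [f [rs def_rs]]] := splitting_extension (char_poly_monic A).
have : integralOver (f \o j) (f (char_poly A)`_i).
  rewrite -coef_map def_rs; apply: integral_coef_prod_XsubC => r rs_r.
  exists q; rewrite //; apply: char_poly_root_annihilator.
  by rewrite def_rs root_prod_XsubC.
case=> p mon_p; rewrite map_poly_comp fmorph_root => rp.
by exists p.
Qed.

(** In a splitting field each linear factor of the characteristic polynomial
    divides [q]. Divisibility descends to [Z] because the remainder of a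
    division by a monic polynomial does not depend on the ring of coefficients. *)
Lemma char_poly_dvd_annihilator (p : {poly Z}) :
  injective j -> map_poly j p = char_poly A ->
  exists n h, q ^+ n = h * p.
Proof.
move=> j_inj def_p; have [E [f [rs def_rs]]] := splitting_extension (char_poly_monic A).
have mon_p : p \is monic.
  have := char_poly_monic A; rewrite -def_p !monicE lead_coef_map_inj ?rmorph0 //.
  by rewrite -(rmorph1 j) (inj_eq j_inj).
have dvd_E : map_poly f (char_poly A) %| (map_poly (f \o j) q) ^+ (size rs).
  have qr r : r \in rs -> root (map_poly (f \o j) q) r.
    move=> rs_r; apply: char_poly_root_annihilator.
    by rewrite def_rs root_prod_XsubC.
  rewrite def_rs; elim: rs {def_rs} qr => [|r rs IHrs] qr.
    by rewrite big_nil dvd1p.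
  rewrite big_cons exprS; apply: dvdp_mul.
    by rewrite dvdp_XsubCl; apply: qr; rewrite mem_head.
  by apply: IHrs => s rs_s; apply: qr; rewrite inE rs_s orbT.
have dvd_F : char_poly A %| map_poly j (q ^+ size rs).
  by move: dvd_E; rewrite map_poly_comp -rmorphXn /= dvdp_map -rmorphXn.
exists (size rs), (q ^+ size rs %/ p).
rewrite {1}(Pdiv.IdomainMonic.divp_eq mon_p (q ^+ size rs)).
suff -> : q ^+ size rs %% p = 0 by rewrite addr0.
apply: (map_inj_poly j_inj (rmorph0 j)); rewrite rmorph0.
set m := _ %% p.
have : char_poly A %| map_poly j m.
  have -> : m = q ^+ size rs - (q ^+ size rs %/ p) * p.
    apply/eqP; rewrite eq_sym subr_eq addrC; apply/eqP.
    exact: Pdiv.IdomainMonic.divp_eq.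
  by rewrite rmorphB rmorphM /= def_p dvdp_sub // dvdp_mulIr.
have lt_mp : (size (map_poly j m) < size (char_poly A))%N.
  rewrite -def_p !size_map_inj_poly ?rmorph0 // ltn_modp //.
  exact: monic_neq0.
by move/dvdp_leq; case: eqP => // _ /(_ isT); rewrite leqNgt lt_mp.
Qed.

End MonicAnnihilator.

Definition integrally_closed (Z F : nzRingType) (j : Z -> F) :=
  forall f, integralOver j f -> exists z, f = j z.

(** Integral closedness makes it possible to reduce the characteristic polynomial
    modulo the kernel of [chi] although the matrix itself has denominators;
    [rs] are the eigenvalues of this virtual reduction. *)
Lemma char_poly_reduction (Z : idomainType) (F : fieldType)
    (j : {rmorphism Z -> F}) (K : closedFieldType) (chi : {rmorphism Z -> K})
    (D : nat) (A : 'M[F]_D.+1) (q : {poly Z}) :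
  injective j -> integrally_closed j -> q \is monic ->
  horner_mx A (map_poly j q) = 0 ->
  exists (p : {poly Z}) (rs : seq K),
    [/\ map_poly j p = char_poly A, size rs = D.+1,
        map_poly chi p = \prod_(r <- rs) ('X - r%:P),
        forall r, r \in rs -> root (map_poly chi q) r &
        exists2 t, \tr A = j t & chi t = \sum_(r <- rs) r].
Proof.
move=> j_inj j_cl mon_q qA.
have [c def_c] : {c : nat -> Z & forall i, (char_poly A)`_i = j (c i)}.
  apply: (@choice _ _ (fun i z => (char_poly A)`_i = j z)) => i.
  exact/j_cl/(integral_char_poly mon_q qA).
pose p := \poly_(i < D.+2) c i.
have def_p : map_poly j p = char_poly A.
  apply/polyP=> i; rewrite coef_map coef_poly; case: ltnP => [_|lt_Di].
    by rewrite def_c.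
  by rewrite raddf0 nth_default // size_char_poly.
have mon_p : p \is monic.
  have := char_poly_monic A; rewrite -def_p !monicE lead_coef_map_inj ?rmorph0 //.
  by rewrite -(rmorph1 j) (inj_eq j_inj).
have [n [h def_q]] := char_poly_dvd_annihilator qA j_inj def_p.
have [rs def_rs] := closed_field_poly_normal (map_poly chi p).
have mon_cp : map_poly chi p \is monic by apply: monic_map.
rewrite (monicP mon_cp) scale1r in def_rs.
have sz_rs : size rs = D.+1.
  apply: succn_inj; rewrite -(size_prod_XsubC rs id) /= -def_rs.
  rewrite size_map_poly_id0 ?(monicP mon_p) ?rmorph1 ?oner_eq0 //.
  by rewrite -(size_map_inj_poly j_inj (rmorph0 j)) def_p size_char_poly.
exists p, rs; split=> // [r rs_r|].
  have : root (map_poly chi (q ^+ n)) r.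
    by rewrite def_q rmorphM /= rootM def_rs root_prod_XsubC rs_r orbT.
  rewrite rmorphXn /= rootE horner_exp; case: n {def_q} => [|n].
    by rewrite expr0 oner_eq0.
  by rewrite expf_eq0.
exists (- c D).
  by rewrite rmorphN -def_c (char_poly_trace A (ltn0Sn D)) opprK.
have := @coefPn_prod_XsubC _ rs; rewrite -def_rs sz_rs => /(_ isT) /=.
by rewrite coef_map coef_poly /= leqnSn rmorphN => ->; rewrite opprK.
Qed.

Section FreeFamily.

Variables (Z : idomainType) (R : nzRingType) (iota : {rmorphism Z -> R}).

Definition lin_comb (c : nat -> Z) (s : seq R) :=
  \sum_(i < size s) iota (c i) * s`_i.

Lemma lin_comb_cons c a s : lin_comb c (a :: s) = iota (c 0%N) * a + lin_comb (c \o S) s.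
Proof. by rewrite /lin_comb big_ord_recl. Qed.

Lemma lin_combD c d s : lin_comb c s + lin_comb d s = lin_comb (fun i => c i + d i) s.
Proof. by rewrite -big_split; apply: eq_bigr => i _; rewrite rmorphD mulrDl. Qed.

Lemma lin_combZ z c s : iota z * lin_comb c s = lin_comb (fun i => z * c i) s.
Proof. by rewrite mulr_sumr; apply: eq_bigr => i _; rewrite rmorphM mulrA. Qed.

(** The generic rank exists: a finite family contains, up to a common
    denominator [w], a free generating subfamily. *)
Lemma free_subfamily (s : seq R) :
  exists (t : seq R) (w : Z), [/\ w != 0,
    forall c, lin_comb c t = 0 -> forall i, (i < size t)%N -> c i = 0 &
    forall a, a \in s -> exists c, iota w * a = lin_comb c t].
Proof.
elim: s => [|a s [t [w [w0 free_t gen_t]]]].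
  by exists [::], 1; split=> //; apply: oner_neq0.
have [[z z0 [c def_c]]|nt] := pselect (exists2 z, z != 0 & exists c, iota z * a = lin_comb c t).
  exists t, (z * w); split=> // [|b]; first by rewrite mulf_neq0.
  rewrite inE => /predU1P[->|/gen_t[d def_d]].
    by exists (fun i => w * c i); rewrite mulrC rmorphM -mulrA def_c lin_combZ.
  by exists (fun i => z * d i); rewrite rmorphM -mulrA def_d lin_combZ.
exists (a :: t), w; split=> // [c|b].
  rewrite lin_comb_cons => c0.
  have c00 : c 0%N = 0.
    apply: contrapT => /eqP c00; apply: nt; exists (c 0%N) => //.
    exists (fun i => - 1 * c i.+1); rewrite -lin_combZ rmorphN1 mulN1r.
    by apply/eqP; rewrite -subr_eq0 opprK; apply/eqP.
  move: c0; rewrite c00 rmorph0 mul0r add0r => /free_t c0 [|i] //.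
  exact: c0.
rewrite inE => /predU1P[->|/gen_t[d def_d]].
  exists (fun i => if i is 0%N then w else 0); rewrite lin_comb_cons /= /lin_comb big1 ?addr0 //.
  by move=> i _; rewrite /= rmorph0 mul0r.
by exists (fun i => if i is i1.+1 then d i1 else 0); 
  rewrite lin_comb_cons rmorph0 mul0r add0r def_d.
Qed.

Lemma generic_basis n (v : 'I_n -> R) :
  injective iota ->
  (forall a, exists c : 'I_n -> Z, a = \sum_i iota (c i) * v i) ->
  exists (D : nat) (u : 'I_D.+1 -> R) (w : Z), [/\ w != 0,
    forall c, \sum_i iota (c i) * u i = 0 -> forall i, c i = 0 &
    forall a, exists c, iota w * a = \sum_i iota (c i) * u i].
Proof.
move=> iota_inj span_v.
have [t [w [w0 free_t gen_t]]] := free_subfamily (codom v).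
have gen a : exists c, iota w * a = lin_comb c t.
  have [c ->] := span_v a; rewrite mulr_sumr.
  elim/big_rec: _ => [|i x _ [d ->]].
    exists (fun=> 0); rewrite /lin_comb big1 // => i _; rewrite rmorph0 mul0r //.
  have [e def_e] := gen_t _ (codom_f v i).
  exists (fun k => c i * e k + d k).
  by rewrite -lin_combD -lin_combZ -def_e mulrA -rmorphM mulrC rmorphM -mulrA.
case: t {gen_t} free_t gen => [_|u0 t] /=.
  case/(_ 1)=> c; rewrite /lin_comb big_ord0 mulr1 => /eqP.
  by rewrite -(rmorph0 iota) (inj_eq iota_inj) (negPf w0).
move=> free_t gen; exists (size t), (fun i => (u0 :: t)`_i), w; split=> // [c c0 i|a].
  have := free_t (fun k => c (inord k)) _ i (ltn_ord i).
  rewrite inord_val; apply; rewrite -[RHS]c0; apply: eq_bigr => k _.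
  by rewrite inord_val.
by have [c ->] := gen a; exists c.
Qed.

End FreeFamily.

(** * Linear algebra over the field of fractions of the centre *)

Section GenericMatrices.

Variables (Z : idomainType) (R : nzRingType) (iota : {rmorphism Z -> R}).
Variables (F : fieldType) (j : {rmorphism Z -> F}).
Variables (D : nat) (u : 'I_D.+1 -> R) (w : Z).
Hypotheses (iotaC : forall z a, iota z * a = a * iota z).
Hypotheses (iota_inj : injective iota) (j_inj : injective j).
Hypothesis fracF : forall f, exists n d, d != 0 /\ f * j d = j n.
Hypothesis w0 : w != 0.
Hypothesis free_u : forall c, \sum_i iota (c i) * u i = 0 -> forall i, c i = 0.
Hypothesis gen_u : forall a, exists c, iota w * a = \sum_i iota (c i) * u i.

Let j_eq0 z : (j z == 0) = (z == 0).
Proof. by rewrite -(inj_eq j_inj) rmorph0. Qed.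

Let numcoord a : 'I_D.+1 -> Z := projT1 (cid (gen_u a)).
(** The family [u] only generates a submodule that contains [w R], so that
    coordinates have denominators. *)
Definition coords a : 'rV[F]_D.+1 := \row_i (j (numcoord a i) / j w).

Lemma coordE z c a : z != 0 -> iota z * a = \sum_i iota (c i) * u i ->
  j z *: coords a = \row_i j (c i).
Proof.
move=> z0 def_za; apply/rowP=> i; rewrite !mxE.
have def_wa := projT2 (cid (gen_u a)); rewrite -/(numcoord a) in def_wa.
have /(_ i)/eqP : forall i, z * numcoord a i - w * c i = 0.
  apply: free_u; under eq_bigr do rewrite rmorphB !rmorphM mulrBl -!mulrA.
  by rewrite sumrB -!mulr_sumr -def_za -def_wa !mulrA -!rmorphM mulrC subrr.
rewrite subr_eq0 => /eqP/(congr1 j); rewrite !rmorphM mulrA => ->.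
by rewrite mulrC mulKf ?j_eq0.
Qed.

Lemma coord_u i : coords (u i) = delta_mx 0 i.
Proof.
rewrite -[LHS]scale1r -(rmorph1 j) (@coordE 1 (fun k => (k == i)%:R)) ?oner_neq0 //.
  by apply/rowP=> k; rewrite !mxE eqxx rmorph_nat.
rewrite rmorph1 mul1r (bigD1 i) //= eqxx rmorph1 mul1r big1 ?addr0 // => k /negPf->.
by rewrite rmorph0 mul0r.
Qed.

Lemma coordD a b : coords (a + b) = coords a + coords b.
Proof.
have [[c def_a] [d def_b]] := (gen_u a, gen_u b).
apply: (scalerI (a := j w)); first by rewrite j_eq0.
rewrite scalerDr (coordE w0 def_a) (coordE w0 def_b).
rewrite (@coordE w (fun i => c i + d i)) //.
  by apply/rowP=> i; rewrite !mxE rmorphD.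
by rewrite mulrDr def_a def_b -big_split; apply: eq_bigr => i _; rewrite rmorphD mulrDl.
Qed.

Lemma coordZ z a : coords (iota z * a) = j z *: coords a.
Proof.
have [c def_a] := gen_u a.
apply: (scalerI (a := j w)); first by rewrite j_eq0.
rewrite scalerA mulrC -scalerA (coordE w0 def_a).
rewrite (@coordE w (fun i => z * c i)) //.
  by apply/rowP=> i; rewrite !mxE rmorphM.
rewrite mulrA -rmorphM mulrC rmorphM -mulrA def_a mulr_sumr.
by apply: eq_bigr => i _; rewrite rmorphM mulrA.
Qed.

Lemma coord0 : coords 0 = 0.
Proof. by rewrite -(mulr0 (iota 0)) coordZ rmorph0 scale0r. Qed.

Lemma coordN a : coords (- a) = - coords a.
Proof. by rewrite -mulN1r -(rmorphN1 iota) coordZ rmorphN1 scaleN1r. Qed.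

Lemma coordB a b : coords (a - b) = coords a - coords b.
Proof. by rewrite coordD coordN. Qed.

Lemma coord_sum I r (P : pred I) (G : I -> R) :
  coords (\sum_(i <- r | P i) G i) = \sum_(i <- r | P i) coords (G i).
Proof. by rewrite (big_morph coords coordD coord0). Qed.

Hypothesis domR : forall a b : R, a * b = 0 -> a = 0 \/ b = 0.

Lemma coord_eq0 a : coords a = 0 -> a = 0.
Proof.
move=> a0; have [c def_a] := gen_u a.
have : iota w * a = 0.
  rewrite def_a big1 // => i _.
  have /rowP/(_ i) := coordE w0 def_a; rewrite a0 scaler0 !mxE => /esym/eqP.
  by rewrite j_eq0 => /eqP->; rewrite rmorph0 mul0r.
case/domR=> // /eqP; rewrite -(rmorph0 iota) (inj_eq iota_inj).
by rewrite (negPf w0).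
Qed.

Lemma common_denominator n (x : 'I_n -> F) :
  exists2 d, d != 0 & exists c, forall i, x i * j d = j (c i).
Proof.
have [f def_f] : {f : 'I_n -> Z * Z & forall i, (f i).2 != 0 /\ x i * j (f i).2 = j (f i).1}.
  apply: (@choice _ _ (fun i f => f.2 != 0 /\ x i * j f.2 = j f.1)) => i.
  by have [a [b [b0 def_x]]] := fracF (x i); exists (a, b).
exists (\prod_i (f i).2); first by apply/prodf_neq0=> i _; have [] := def_f i.
exists (fun i => (f i).1 * \prod_(k | k != i) (f k).2) => i.
by rewrite (bigD1 i) //= !rmorphM mulrA; have [_ ->] := def_f i.
Qed.

Lemma coord_onto (x : 'rV[F]_D.+1) :
  exists2 z, z != 0 & exists a, coords a = j z *: x.
Proof.
have [d d0 [c def_x]] := common_denominator (x 0).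
exists d => //; exists (\sum_i iota (c i) * u i).
rewrite coord_sum; apply/rowP=> i; rewrite mxE mulrC def_x summxE.
rewrite (bigD1 i) //= coordZ coord_u !mxE !eqxx mulr1 big1 ?addr0 // => k ki.
by rewrite coordZ coord_u !mxE eqxx eq_sym (negPf ki) mulr0.
Qed.

Definition Zlinear (phi : R -> R) :=
  (forall a b, phi (a + b) = phi a + phi b)
  /\ forall z a, phi (iota z * a) = iota z * phi a.

(** Vectors of coordinates are rows, hence matrices act on the right. *)
Definition mat (phi : R -> R) : 'M[F]_D.+1 := \matrix_(i, k) coords (phi (u i)) 0 k.

Lemma row_mat phi i : row i (mat phi) = coords (phi (u i)).
Proof. by apply/rowP=> k; rewrite !mxE. Qed.

Lemma coord_mat phi a : Zlinear phi -> coords (phi a) = coords a *m mat phi.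
Proof.
move=> [phiD phiZ]; have [c def_a] := gen_u a.
have phi0 : phi 0 = 0 by rewrite -[in LHS](mulr0 (iota 0)) phiZ rmorph0 mul0r.
apply: (scalerI (a := j w)); first by rewrite j_eq0.
rewrite scalemxAl (coordE w0 def_a) -coordZ -phiZ def_a.
rewrite (big_morph phi phiD phi0) coord_sum mulmx_sum_row.
by apply: eq_bigr => i _; rewrite phiZ coordZ mxE row_mat.
Qed.

Lemma mat_eq phi (A : 'M[F]_D.+1) :
  (forall a, coords (phi a) = coords a *m A) -> mat phi = A.
Proof.
by move=> phiA; apply/row_matrixP=> i; rewrite row_mat phiA coord_u rowE.
Qed.

Lemma mat_comp phi psi : Zlinear phi -> Zlinear psi ->
  mat (fun a => phi (psi a)) = mat psi *m mat phi.
Proof. by move=> ? ?; apply: mat_eq => a; rewrite !coord_mat // mulmxA. Qed.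

Lemma lmul_linear a : Zlinear ( *%R a).
Proof.
by split=> [b c|z b]; rewrite ?mulrDr // !mulrA iotaC.
Qed.

Lemma rmul_linear b : Zlinear ( *%R^~ b).
Proof. by split=> [a c|z a]; rewrite /= ?mulrDl // !mulrA. Qed.

Lemma lrmul_linear a b : Zlinear (fun c => a * c * b).
Proof.
by split=> [c d|z c]; rewrite ?mulrDr ?mulrDl // !mulrA -iotaC.
Qed.

Definition trL a := \tr (mat ( *%R a)).
Definition trLR a b := \tr (mat (fun c => a * c * b)).

Lemma mat_lrmul a b :
  mat (fun c => a * c * b) = mat ( *%R a) *m mat ( *%R^~ b).
Proof. exact: mat_comp (rmul_linear b) (lmul_linear a). Qed.

Lemma mat_lmulM a b : mat ( *%R (a * b)) = mat ( *%R b) *m mat ( *%R a).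
Proof.
rewrite -mat_comp; try exact: lmul_linear.
by congr mat; apply/funext=> c; rewrite mulrA.
Qed.

Lemma mat_lmulD a b : mat ( *%R (a + b)) = mat ( *%R a) + mat ( *%R b).
Proof.
apply: mat_eq => c.
by rewrite mulmxDr -!coord_mat -?coordD ?mulrDl //; apply: lmul_linear.
Qed.

Lemma mat_lmulZ z a : mat ( *%R (iota z * a)) = j z *: mat ( *%R a).
Proof.
apply: mat_eq => c.
by rewrite -scalemxAr -coord_mat -?coordZ ?mulrA //; apply: lmul_linear.
Qed.

Lemma mat_lmul1 : mat ( *%R 1) = 1%:M.
Proof. by apply: mat_eq => a; rewrite mulmx1 mul1r. Qed.

Lemma mat_lrmulC a b :
  mat ( *%R a) *m mat ( *%R^~ b) = mat ( *%R^~ b) *m mat ( *%R a).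
Proof.
rewrite -mat_lrmul -mat_comp; [|exact: lmul_linear|exact: rmul_linear].
by congr mat; apply/funext=> c; rewrite mulrA.
Qed.

(** Left multiplication by [a] is injective, hence invertible over the field of
    fractions: the inverse of [a] is an element of [R] divided by a central
    one. *)
Lemma central_multiple a : a != 0 -> exists b z, z != 0 /\ a * b = iota z.
Proof.
move=> a0; have detA : \det (mat ( *%R a)) != 0.
  apply/det0P=> -[x x0 xA]; have [z z0 [b def_b]] := coord_onto x.
  have /domR[ea|eb] : a * b = 0.
  - by apply: coord_eq0; rewrite coord_mat ?def_b -?scalemxAl ?xA ?scaler0 //; apply: lmul_linear.
  - by rewrite ea eqxx in a0.
  move: def_b; rewrite eb coord0 => /esym/eqP; rewrite scaler_eq0 (negPf x0) orbF.
  by rewrite j_eq0 (negPf z0).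
have uA : mat ( *%R a) \in unitmx by rewrite unitmxE unitfE.
have [z z0 [b def_b]] := coord_onto (coords 1 *m invmx (mat ( *%R a))).
exists b, z; split=> //; apply/eqP; rewrite -subr_eq0; apply/eqP/coord_eq0.
rewrite coordB coord_mat; last exact: lmul_linear.
by rewrite def_b -scalemxAl mulmxKV // -[iota z]mulr1 coordZ subrr.
Qed.

Hypothesis charF : forall n, n.+1%:R != 0 :> F.
Hypothesis iota_center : forall a, (forall b, a * b = b * a) -> exists z, a = iota z.

Lemma trL_iota z : trL (iota z) = j z * D.+1%:R.
Proof. by rewrite /trL -[iota z]mulr1 mat_lmulZ mat_lmul1 linearZ /= mxtrace1. Qed.

Lemma trLC a b : trL (a * b) = trL (b * a).
Proof. by rewrite /trL !mat_lmulM mxtrace_mulC. Qed.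

Lemma trLD a b : trL (a + b) = trL a + trL b.
Proof. by rewrite /trL mat_lmulD linearD. Qed.

Lemma trLZ z a : trL (iota z * a) = j z * trL a.
Proof. by rewrite /trL mat_lmulZ linearZ. Qed.

Lemma trL_nondegenerate a : (forall b, trL (a * b) = 0) -> a = 0.
Proof.
move=> a_perp; apply: contrapT => /eqP/central_multiple[b [z [z0 def_ab]]].
have := a_perp b; rewrite def_ab trL_iota => /eqP.
by rewrite mulf_eq0 j_eq0 (negPf z0) (negPf (charF D)).
Qed.

(** Over the centre, a linear form is represented by the trace form, and a form
    that vanishes on commutators is represented by a central element: it is a
    multiple of the trace. *)
Lemma trace_unique (lam : R -> F) :
  (forall a b, lam (a + b) = lam a + lam b) ->
  (forall z a, lam (iota z * a) = j z * lam a) ->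
  (forall a b, lam (a * b) = lam (b * a)) ->
  forall a, lam a * D.+1%:R = lam 1 * trL a.
Proof.
move=> lamD lamZ lamC.
have lam0 : lam 0 = 0 by rewrite -(mulr0 (iota 0)) lamZ rmorph0 mul0r.
have trL0 : trL 0 = 0 by rewrite -(mulr0 (iota 0)) trLZ rmorph0 mul0r.
have eq_on_u f g : (forall a b, f (a + b) = f a + f b) ->
    (forall z a, f (iota z * a) = j z * f a) ->
    (forall a b, g (a + b) = g a + g b) ->
    (forall z a, g (iota z * a) = j z * g a) ->
    (forall i, f (u i) = g (u i)) -> forall a, f a = g a :> F.
  move=> fD fZ gD gZ fg a; have [c def_a] := gen_u a.
  apply: (mulfI (x := j w)); first by rewrite j_eq0.
  have f0 : f 0 = 0 by rewrite -(mulr0 (iota 0)) fZ rmorph0 mul0r.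
  have g0 : g 0 = 0 by rewrite -(mulr0 (iota 0)) gZ rmorph0 mul0r.
  rewrite -fZ -gZ def_a (big_morph f fD f0) (big_morph g gD g0).
  by apply: eq_bigr => i _; rewrite fZ gZ fg.
(* The Gram matrix of the trace form; its invertibility is nondegeneracy. *)
pose G : 'M[F]_D.+1 := \matrix_(i, k) trL (u i * u k).
have GE (x : 'rV[F]_D.+1) z b : coords b = j z *: x ->
    forall k, j z * (x *m G) 0 k = trL (b * u k).
  move=> def_b k; rewrite mxE mulr_sumr.
  have [c def_wb] := gen_u b.
  apply: (mulfI (x := j w)); first by rewrite j_eq0.
  rewrite -trLZ mulrA def_wb mulr_suml (big_morph trL trLD trL0) mulr_sumr.
  apply: eq_bigr => i _; rewrite -mulrA trLZ mxE !mulrA; congr (_ * _).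
  have /rowP/(_ i) := coordE w0 def_wb; rewrite def_b !mxE => <-.
  by rewrite !mulrA.
have uG : G \in unitmx.
  rewrite unitmxE unitfE; apply/det0P=> -[x x0 xG].
  have [z z0 [b def_b]] := coord_onto x.
  have b0 : b = 0.
    apply: trL_nondegenerate => a.
    apply: (eq_on_u (fun a => trL (b * a)) (fun=> 0)) => [c d|y c|c d|y c|i].
    - by rewrite mulrDr trLD.
    - by rewrite mulrA -iotaC -mulrA trLZ.
    - by rewrite addr0.
    - by rewrite mulr0.
    - by rewrite -(GE _ _ _ def_b) xG mxE mulr0.
  move: def_b; rewrite b0 coord0 => /esym/eqP; rewrite scaler_eq0 (negPf x0) orbF.
  by rewrite j_eq0 (negPf z0).
have [z z0 [b def_b]] := coord_onto ((\row_k lam (u k)) *m invmx G).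
have lamE a : j z * lam a = trL (b * a).
  apply: (eq_on_u (fun a => j z * lam a) (fun a => trL (b * a))) => [c d|y c|c d|y c|k].
  - by rewrite lamD mulrDr.
  - by rewrite lamZ mulrCA.
  - by rewrite mulrDr trLD.
  - by rewrite mulrA -iotaC -mulrA trLZ.
  - by rewrite -(GE _ _ _ def_b) mulmxKV // mxE.
(* The element b that represents lam commutes with everything, because lam
   vanishes on commutators and the trace form is nondegenerate. *)
have [y def_y] : exists y, b = iota y.
  apply: iota_center => a; apply/eqP; rewrite -subr_eq0; apply/eqP.
  apply: trL_nondegenerate => c; rewrite mulrBl trLD -mulN1r -(rmorphN1 iota).
  rewrite -mulrA -mulrA trLZ rmorphN1 mulN1r; apply/eqP; rewrite subr_eq0.
  by rewrite (trLC a) -mulrA -!lamE lamC.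
move=> a; apply: (mulfI (x := j z)); first by rewrite j_eq0.
by rewrite !mulrA !lamE def_y mulr1 trLZ trL_iota mulrAC.
Qed.

(** For a fixed [b] the left-hand side, as a function of [a], is linear over the
    centre and vanishes on commutators, because left and right multiplications
    commute: it is a multiple of the trace. *)
Lemma trace_lrmul a b : trLR a b * D.+1%:R = trLR 1 b * trL a.
Proof.
have E c : trLR c b = \tr (mat ( *%R c) *m mat ( *%R^~ b)) by rewrite /trLR mat_lrmul.
apply: (trace_unique (lam := fun c => trLR c b)) => [c d|z c|c d].
- by rewrite !E mat_lmulD mulmxDl linearD.
- by rewrite !E mat_lmulZ -scalemxAl linearZ.
- by rewrite !E !mat_lmulM -mulmxA mat_lrmulC mulmxA mxtrace_mulC mulmxA.
Qed.

End GenericMatrices.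

(** * Idempotents of a fibre *)

Lemma horner_mx_comp (F : fieldType) (n : nat) (A : 'M[F]_n.+1) (p q : {poly F}) :
  horner_mx A (p \Po q) = horner_mx (horner_mx A q) p.
Proof.
elim/poly_ind: p => [|p c IHp]; first by rewrite comp_poly0 !rmorph0.
rewrite comp_poly_MXaddC !rmorphD !rmorphM /= IHp horner_mx_X.
by rewrite !horner_mx_C.
Qed.

Lemma char_poly0 (K : fieldType) n : char_poly (0 : 'M[K]_n) = 'X^n.
Proof. by rewrite /char_poly /char_poly_mx map_mx0 subr0 det_scalar. Qed.

Section FiberIdempotents.

Variables (Z : idomainType) (R : nzRingType) (iota : {rmorphism Z -> R}).
Variables (K : closedFieldType) (chi : {rmorphism Z -> K}).

Definition fiber_ideal (a : R) :=
  exists m (z : 'I_m -> Z) (b : 'I_m -> R),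
    (forall i, chi (z i) = 0) /\ a = \sum_i iota (z i) * b i.

Hypotheses (iotaC : forall z a, iota z * a = a * iota z).

Lemma fiber_ideal0 : fiber_ideal 0.
Proof.
exists 0%N, (fun=> 0), (fun=> 0); split; last by rewrite big_ord0.
by move=> i; rewrite rmorph0.
Qed.

Lemma fiber_idealM z a : chi z = 0 -> fiber_ideal (iota z * a).
Proof.
move=> z0; exists 1%N, (fun=> z), (fun=> a); split=> //.
by rewrite big_ord1.
Qed.

Lemma fiber_idealD a b : fiber_ideal a -> fiber_ideal b -> fiber_ideal (a + b).
Proof.
move=> [m [y [c [y0 ->]]]] [n [z [d [z0 ->]]]].
exists (m + n)%N, (fun i => match split i with inl k => y k | inr k => z k end),
  (fun i => match split i with inl k => c k | inr k => d k end).
split=> [i|]; first by case: (split i).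
rewrite big_split_ord /=; congr (_ + _); apply: eq_bigr => i _.
  by rewrite (unsplitK (inl i)).
by rewrite (unsplitK (inr i)).
Qed.

Lemma fiber_ideal_linear phi a :
  Zlinear iota phi -> fiber_ideal a -> fiber_ideal (phi a).
Proof.
move=> [phiD phiZ] [m [y [c [y0 ->]]]]; exists m, y, (phi \o c); split=> //.
have phi0 : phi 0 = 0 by rewrite -[in LHS](mulr0 (iota 0)) phiZ rmorph0 mul0r.
by rewrite (big_morph phi phiD phi0); apply: eq_bigr => i _; rewrite phiZ.
Qed.

Lemma fiber_idealMl a b : fiber_ideal b -> fiber_ideal (a * b).
Proof. exact/fiber_ideal_linear/lmul_linear. Qed.

Lemma fiber_idealMr a b : fiber_ideal a -> fiber_ideal (a * b).
Proof. exact: (fiber_ideal_linear (rmul_linear iota b)). Qed.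

Lemma fiber_idealB a b : fiber_ideal a -> fiber_ideal b -> fiber_ideal (a - b).
Proof.
by move=> Ia Ib; apply: fiber_idealD => //; rewrite -mulN1r; apply: fiber_idealMl.
Qed.

Lemma fiber_ideal_sum I (r : seq I) (P : pred I) (G : I -> R) :
  (forall i, P i -> fiber_ideal (G i)) -> fiber_ideal (\sum_(i <- r | P i) G i).
Proof.
by move=> IG; apply: big_ind => //; [apply: fiber_ideal0 | apply: fiber_idealD].
Qed.

Variables (F : fieldType) (j : {rmorphism Z -> F}).
Hypotheses (iota_inj : injective iota) (j_inj : injective j).
Hypothesis fracF : forall f, exists n d, d != 0 /\ f * j d = j n.
Hypothesis j_closed : integrally_closed j.
Hypothesis domR : forall a b : R, a * b = 0 -> a = 0 \/ b = 0.
Hypothesis iota_center : forall a, (forall b, a * b = b * a) -> exists z, a = iota z.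
Hypothesis charK : [pchar K] =i pred0.
Variables (N : nat) (v : 'I_N.+1 -> R).
Hypothesis span_v : forall a, exists c : 'I_N.+1 -> Z, a = \sum_i iota (c i) * v i.

Section Basis.

Variables (D : nat) (u : 'I_D.+1 -> R) (w : Z).
Hypothesis w0 : w != 0.
Hypothesis free_u : forall c, \sum_i iota (c i) * u i = 0 -> forall i, c i = 0.
Hypothesis gen_u : forall a, exists c, iota w * a = \sum_i iota (c i) * u i.

Local Notation mat := (mat j gen_u).
Local Notation coords := (coords j gen_u).

(** Cayley-Hamilton for an endomorphism of a finite, not necessarily free,
    module that maps it into a multiple of itself. *)
Lemma annihilator_mod phi : Zlinear iota phi -> (forall a, fiber_ideal (phi a)) ->
  exists2 q : {poly Z}, q \is monic /\ horner_mx (mat phi) (map_poly j q) = 0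
    & map_poly chi q = 'X^(N.+1).
Proof.
move=> lin_phi phi_m.
have [m def_m] : {m : 'I_N.+1 -> 'I_N.+1 -> Z & forall i,
    (forall k, chi (m i k) = 0) /\ phi (v i) = \sum_k iota (m i k) * v k}.
  apply: (@choice _ _ (fun i m => (forall k, chi (m k) = 0)
    /\ phi (v i) = \sum_k iota (m k) * v k)) => i.
  have [n [z [b [z0 ->]]]] := phi_m (v i).
  have [c def_c] := choice (fun k => span_v (b k)).
  exists (fun k => \sum_h z h * c h k); split=> [k|].
    by rewrite rmorph_sum big1 // => h _; rewrite rmorphM /= z0 mul0r.
  under [RHS]eq_bigr do rewrite rmorph_sum mulr_suml.
  rewrite exchange_big /=; apply: eq_bigr => h _.
  by rewrite {1}def_c mulr_sumr; apply: eq_bigr => k _; rewrite rmorphM mulrA.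
pose P : 'M[Z]_N.+1 := \matrix_(i, k) m i k.
pose V : 'M[F]_(N.+1, D.+1) := \matrix_i coords (v i).
have VP : V *m mat phi = map_mx j P *m V.
  apply/row_matrixP=> i; rewrite row_mul rowK -coord_mat //.
  have [_ ->] := def_m i; rewrite coord_sum //.
  by rewrite row_mul mulmx_sum_row; apply: eq_bigr => k _; rewrite coordZ // !mxE rowK.
have VP_horner p : V *m horner_mx (mat phi) p = horner_mx (map_mx j P) p *m V.
  elim/poly_ind: p => [|p c IHp]; first by rewrite !rmorph0 mulmx0 mul0mx.
  rewrite !rmorphD !rmorphM /= !horner_mx_X !horner_mx_C.
  rewrite mulmxDr mulmxA IHp -mulmxA VP mulmxA mulmxDl; congr (_ + _).
  by rewrite mul_mx_scalar mul_scalar_mx.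
(* The generators span, so V can be cancelled although it is not square. *)
have [W WV] : exists W : 'M[F]_(D.+1, N.+1), W *m V = 1%:M.
  have [c def_c] := choice (fun i => span_v (u i)).
  exists (\matrix_(i, k) j (c i k)); apply/row_matrixP=> i.
  rewrite row_mul mulmx_sum_row row1 -(coord_u j_inj w0 free_u gen_u).
  rewrite def_c coord_sum //; apply: eq_bigr => k _.
  by rewrite coordZ // !mxE rowK.
exists (char_poly P); last first.
  by rewrite map_char_poly (_ : map_mx _ _ = 0) ?char_poly0 //;
    apply/matrixP=> i k; rewrite !mxE; have [-> _] := def_m i.
split; first exact: char_poly_monic.
rewrite -[LHS]mul1mx -WV -mulmxA VP_horner map_char_poly Cayley_Hamilton.
by rewrite mul0mx mulmx0.
Qed.

(** Modulo the kernel of [chi] the eigenvalues of [phi] are 0 and 1, and the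
    trace counts the latter. In characteristic zero it only vanishes if the
    characteristic polynomial reduces to a power of the variable; then some
    iterate of [phi] takes its values in the ideal generated by the kernel, and
    so does [phi], which is congruent to its iterates. *)
Lemma idempotent_trace phi : Zlinear iota phi ->
    (forall a, fiber_ideal (phi (phi a) - phi a)) ->
  exists2 t, \tr (mat phi) = j t & (exists k, chi t = k%:R)
    /\ (chi t = 0 -> forall a, fiber_ideal (phi a)).
Proof.
move=> lin_phi phi_idem; have [phiD phiZ] := lin_phi.
have lin_psi : Zlinear iota (fun a => phi (phi a) - phi a).
  split=> [a b|z a]; first by rewrite !phiD opprD addrACA.
  by rewrite !phiZ mulrBr.
have [q [mon_q qA] q_chi] := annihilator_mod lin_psi phi_idem.
pose A := mat phi.
have mat_psi : mat (fun a => phi (phi a) - phi a) = A *m A - A.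
  apply: mat_eq => // a.
  by rewrite coordB // !coord_mat // mulmxBr mulmxA.
(* q kills phi o phi - phi, hence its composite with 'X^2 - 'X kills phi. *)
pose s : {poly Z} := 'X^2 - 'X.
have sz_s : size s = 3%N by rewrite size_polyDl ?size_polyXn // size_polyN size_polyX.
have mon_s : s \is monic.
  by rewrite monicE lead_coefDl ?lead_coefXn // size_polyXn size_polyN size_polyX.
have mon_qs : q \Po s \is monic.
  by rewrite monicE lead_coef_comp ?sz_s // (monicP mon_q) (monicP mon_s) expr1n mulr1.
have qsA : horner_mx A (map_poly j (q \Po s)) = 0.
  rewrite map_comp_poly horner_mx_comp (_ : horner_mx _ (map_poly j s) = A *m A - A).
    by rewrite -mat_psi.
  by rewrite !rmorphB !rmorphXn /= map_polyX horner_mx_X.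
have [p [rs [def_p sz_rs p_chi rs_q [t def_t chi_t]]]] :=
  char_poly_reduction chi j_inj j_closed mon_qs qsA.
have rs01 r : r \in rs -> r = (r != 0)%:R.
  move/rs_q; rewrite map_comp_poly q_chi /root horner_comp hornerXn expf_eq0 /=.
  rewrite rmorphB /= map_polyXn map_polyX !hornerE expr2 -{3}[r]mulr1 -mulrBr mulf_eq0.
  rewrite subr_eq0; case/orP=> /eqP->; rewrite ?eqxx //= oner_eq0 //.
have sum_rs : \sum_(r <- rs) r = (count (predC1 0) rs)%:R.
  rewrite -sum1_count natr_sum [RHS]big_mkcond /= big_seq [RHS]big_seq.
  by apply: eq_bigr => r /rs01 {1}->; rewrite -mulrb.
exists t => //; split; first by exists (count (predC1 0) rs); rewrite chi_t.
rewrite chi_t sum_rs => /eqP; rewrite (iffLR (pcharf0P K) charK) => /eqP/eqP.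
rewrite -leqn0 leqNgt -has_count => /hasPn rs0.
have {}p_chi : map_poly chi p = 'X^(D.+1).
  rewrite p_chi -sz_rs big_seq (eq_bigr (fun=> 'X)).
    by rewrite -big_seq big_const_seq count_predT iter_mulr_1.
  by move=> r /rs0 /negPn /eqP ->; rewrite subr0.
have pA a : \sum_(i < D.+2) iota p`_i * iter i phi a = 0.
  have coord_iter i : coords (iter i phi a) = coords a *m A ^+ i.
    elim: i => [|i IHi]; first by rewrite mulmx1.
    by rewrite iterS coord_mat // IHi exprSr mulmxA.
  apply: (coord_eq0 iota_inj j_inj w0 free_u (gen_u := gen_u) domR).
  rewrite coord_sum //.
  transitivity (coords a *m horner_mx A (map_poly j p)); last first.
    by rewrite def_p Cayley_Hamilton mulmx0.
  have -> : map_poly j p = \poly_(i < D.+2) j p`_i.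
    apply/polyP=> i; rewrite coef_map coef_poly; case: ltnP => // le_i.
    by rewrite -coef_map nth_default //= def_p size_char_poly.
  rewrite poly_def raddf_sum mulmx_sumr; apply: eq_bigr => i _.
  by rewrite coordZ // coord_iter /= horner_mxZ rmorphXn /= horner_mx_X -scalemxAr.
have iter_m i a : fiber_ideal (iter i.+1 phi a - phi a).
  elim: i => [|i IHi]; first by rewrite subrr; apply: fiber_ideal0.
  rewrite -[_ - _](subrKA (phi (phi a))); apply: fiber_idealD => //.
  rewrite iterS; have -> : phi (iter i.+1 phi a) - phi (phi a) = phi (iter i.+1 phi a - phi a).
    have phiN b : phi (- b) = - phi b.
      by rewrite -mulN1r -(rmorphN1 iota) phiZ rmorphN1 mulN1r.
    by rewrite phiD phiN.
  exact: fiber_ideal_linear.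
move=> a; rewrite -[phi a](subKr (iter D.+1 phi a)).
apply: fiber_idealB => //.
have := pA a; rewrite big_ord_recr /=.
have -> : p`_D.+1 = 1.
  apply: j_inj; rewrite -coef_map def_p rmorph1.
  by have /monicP := char_poly_monic A; rewrite lead_coefE size_char_poly.
rewrite rmorph1 mul1r => /eqP; rewrite addrC addr_eq0 => /eqP ->.
rewrite -sub0r; apply: fiber_idealB; first exact: fiber_ideal0.
apply: fiber_ideal_sum => i _; apply: fiber_idealM.
by rewrite -coef_map p_chi coefXn ltn_eqF.
Qed.

(** The trace of [c |-> a * c * b] is computed twice: it vanishes modulo the
    kernel of [chi], and it is, up to a nonzero integer, the product of the
    traces of [a] and [b], which are integers there. *)
Lemma idempotents_linked_basis a b :
  fiber_ideal (a * a - a) -> fiber_ideal (b * b - b) ->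
  (forall c, fiber_ideal (a * c * b)) -> fiber_ideal a \/ fiber_ideal b.
Proof.
move=> a_idem b_idem ab0.
have [q [mon_q qA] q_chi] := annihilator_mod (lrmul_linear iotaC a b) ab0.
have [p [rs [_ _ _ rs_q [t def_t chi_t]]]] :=
  char_poly_reduction chi j_inj j_closed mon_q qA.
have {}chi_t : chi t = 0.
  rewrite chi_t big_seq big1 // => r /rs_q.
  by rewrite q_chi /root hornerXn expf_eq0 => /eqP.
have [ta def_ta [[ka chi_ta] ta0]] : exists2 t, trL j gen_u a = j t &
    (exists k, chi t = k%:R) /\ (chi t = 0 -> forall c, fiber_ideal (a * c)).
  apply: idempotent_trace; first exact: lmul_linear.
  by move=> c; rewrite mulrA -mulrBl; apply: fiber_idealMr.
have [tb def_tb [[kb chi_tb] tb0]] : exists2 t, trLR j gen_u 1 b = j t &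
    (exists k, chi t = k%:R) /\ (chi t = 0 -> forall c, fiber_ideal (1 * c * b)).
  apply: idempotent_trace; first exact: lrmul_linear.
  by move=> c; rewrite !mul1r -mulrA -mulrBr; apply: fiber_idealMl.
have charF k : k.+1%:R != 0 :> F.
  rewrite -(rmorph_nat j) -(rmorph0 j) (inj_eq j_inj).
  by apply: contraTneq isT => /(congr1 chi); rewrite rmorph_nat rmorph0 => /eqP;
    rewrite (iffLR (pcharf0P K) charK).
have := trace_lrmul iotaC iota_inj j_inj fracF w0 free_u gen_u domR charF iota_center a b.
rewrite -[trLR _ _ a b]/(\tr (mat _)) def_t def_ta def_tb -(rmorph_nat j) -!rmorphM.
move/j_inj/(congr1 chi); rewrite !rmorphM /= chi_t mul0r => /esym/eqP.
rewrite mulf_eq0 => /orP[/eqP/tb0 Ib|/eqP/ta0 Ia]; [right|left].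
  by have := Ib 1; rewrite !mul1r.
by have := Ia 1; rewrite mulr1.
Qed.

End Basis.

Theorem idempotents_linked a b :
  fiber_ideal (a * a - a) -> fiber_ideal (b * b - b) ->
  (forall c, fiber_ideal (a * c * b)) -> fiber_ideal a \/ fiber_ideal b.
Proof.
have [D [u [w [w0 free_u gen_u]]]] := generic_basis iota_inj span_v.
exact: (idempotents_linked_basis w0 free_u gen_u).
Qed.

End FiberIdempotents.

(** * The centre of a completely closed domain *)

Definition noncomm_domain (R : nzRingType) :=
  forall a b : R, a * b = 0 -> a = 0 \/ b = 0.

Section Center.

Variable R : nzRingType.

Definition center_pred : {pred R} := fun a => `[< central a >].

Lemma center_predP a : reflect (central a) (a \in center_pred).
Proof. exact: asboolP. Qed.

Lemma center_subring_closed : subring_closed center_pred.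
Proof.
split=> [|a b /center_predP ca /center_predP cb|a b /center_predP ca /center_predP cb].
- by apply/center_predP => b; rewrite mul1r mulr1.
- by apply/center_predP => c; rewrite mulrBl mulrBr ca cb.
- by apply/center_predP => c; rewrite -mulrA cb !mulrA ca.
Qed.

HB.instance Definition _ := GRing.isSubringClosed.Build R center_pred center_subring_closed.

(** The hypothesis that the ambient ring has no zero divisors is a parameter
    of the type, so that the centre can carry a structure of integral domain. *)
Record center (domR : noncomm_domain R) := Center {
  center_val : R;
  center_valP : center_val \in center_pred
}.

Variable domR : noncomm_domain R.
Local Notation Z := (center domR).

HB.instance Definition _ := [isSub for @center_val domR].
HB.instance Definition _ := [Choice of Z by <:].
HB.instance Definition _ := [SubChoice_isSubNzRing of Z by <:].

Lemma center_mulC : commutative (@GRing.mul Z).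
Proof.
move=> a b; apply: val_inj; rewrite !rmorphM /=.
by have /center_predP := center_valP a.
Qed.
HB.instance Definition _ := GRing.PzRing_hasCommutativeMul.Build Z center_mulC.

Definition center_unit : pred Z := fun a => `[< exists b : Z, b * a = 1 >].
Definition center_inv (a : Z) : Z :=
  if pselect (exists b, b * a = 1) is left ex then projT1 (cid ex) else a.

Lemma center_mulV : {in center_unit, left_inverse 1 center_inv *%R}.
Proof.
move=> a /asboolP ex; rewrite /center_inv; case: pselect => // ex'.
by case: (cid ex').
Qed.

Lemma center_unitP (a b : Z) : b * a = 1 -> center_unit a.
Proof. by move=> ba; apply/asboolP; exists b. Qed.

Lemma center_invr_out : {in [predC center_unit], center_inv =1 id}.
Proof.
by move=> a /asboolP nex; rewrite /center_inv; case: pselect.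
Qed.

HB.instance Definition _ := GRing.ComNzRing_hasMulInverse.Build Z
  center_mulV center_unitP center_invr_out.

Lemma center_idomain : GRing.integral_domain_axiom Z.
Proof.
move=> a b /(congr1 val); rewrite rmorphM rmorph0 => /domR[] ab0.
  by apply/orP; left; apply/eqP/val_inj; rewrite rmorph0.
by apply/orP; right; apply/eqP/val_inj; rewrite rmorph0.
Qed.
HB.instance Definition _ := GRing.ComUnitRing_isIntegral.Build Z center_idomain.

End Center.

Lemma fraction_of (Z : idomainType) (f : {fraction Z}) :
  exists n d : Z, d != 0 /\ f * FracField.tofrac d = FracField.tofrac n.
Proof.
elim/quotW: f => x; exists (\n_x), (\d_x); split; first exact: denom_ratioP.
unlock FracField.tofrac; rewrite -[LHS]FracField.pi_mul /FracField.mulf.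
apply/eqP; rewrite FracField.equivf_def !numden_Ratio ?oner_neq0 ?mulr1 ?denom_ratioP //.
by rewrite mulrC.
Qed.

(** A noncommutative, almost-integral form of being a maximal order: a set
    [c O], with [O] an overring of [R] in its ring of fractions that has the
    central element [c] as a common denominator, lies in [c R]. *)
Definition completely_closed (R : nzRingType) :=
  forall (c : R) (W : R -> Prop), central c -> c != 0 ->
    (forall a b, W a -> W b -> W (a + b)) -> (forall a, W (c * a)) ->
    (forall a b, W a -> W b -> exists2 d, W d & a * b = c * d) ->
  forall a, W a -> exists b, a = c * b.

Section CenterClosed.

Variables (R : nzRingType) (domR : noncomm_domain R).
Hypothesis closedR : completely_closed R.
Local Notation Z := (center domR).
Local Notation j := (@FracField.tofrac Z).

Lemma val_centerC (z : Z) a : val z * a = a * val z.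
Proof. by have /center_predP := center_valP z. Qed.

(** For [d k = c * f ^ k], with [c] a common denominator of the powers of an
    integral element [f], this is [c] times the overring [R [f]]. *)
Inductive left_span (d : nat -> R) : R -> Prop :=
| left_span0 : left_span d 0
| left_span_add r k a : left_span d a -> left_span d (r * d k + a).

Lemma left_spanD d a b : left_span d a -> left_span d b -> left_span d (a + b).
Proof.
move=> Wa Wb; elim: Wa => [|r k a' _ IHa]; first by rewrite add0r.
by rewrite -addrA; constructor.
Qed.

Lemma left_spanM (d : nat -> Z) a b :
  (forall h k, d h * d k = d 0%N * d (h + k)%N) ->
  left_span (val \o d) a -> left_span (val \o d) b ->
  exists2 e, left_span (val \o d) e & a * b = val (d 0%N) * e.
Proof.
move=> dd Wa; elim: Wa b => [|r h a' _ IHa] b Wb.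
  by exists 0; rewrite ?mul0r ?mulr0 //; constructor.
have [e We def_e] := IHa _ Wb; rewrite mulrDl {}def_e.
suff [e' We' ->] : exists2 e', left_span (val \o d) e' & r * val (d h) * b = val (d 0%N) * e'.
  by exists (e' + e); rewrite ?mulrDr //; apply: left_spanD.
elim: Wb => [|s k b' _ [e' We' def_e']].
  by exists 0; rewrite ?mulr0 //; constructor.
exists (r * s * val (d (h + k)%N) + e'); first exact: left_span_add.
rewrite mulrDr def_e' mulrDr; congr (_ + _).
rewrite val_centerC /= -!mulrA; congr (r * _); rewrite mulrA val_centerC -!mulrA; congr (s * _).
by have /(congr1 val) := dd h k; rewrite !rmorphM /= => ->; apply: val_centerC.
Qed.

(** An integral element [f] of degree [m] with denominator [w] has all its powers
    in [w ^- m] times the centre. Hence [c O], for [O] the overring generated by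
    [f] and [c = w ^+ m], lies in [c R], and [f] lies in [R]. *)
Lemma center_integrally_closed : integrally_closed j.
Proof.
move=> f [p mon_p /rootP pf0].
have [v [w [w0 def_f]]] := fraction_of f.
pose m := (size p).-1; pose c := w ^+ m.
have sz_p : size p = m.+1 by rewrite prednK // size_poly_gt0 monic_neq0.
have fm : f ^+ m = - \sum_(i < m) j p`_i * f ^+ i.
  move: pf0; rewrite horner_coef size_map_inj_poly ?rmorph0 //; last first.
    by move=> a b /eqP; rewrite tofrac_eq => /eqP.
  rewrite sz_p big_ord_recr /= !coef_map /= -[p`_m]/(lead_coef p) (monicP mon_p).
  rewrite rmorph1 mul1r addrC => /eqP; rewrite addr_eq0 => /eqP->; congr (- _).
  by apply: eq_bigr => i _; rewrite coef_map.
(* High powers of f are reduced by its equation; those below m only need the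
   denominator c. *)
have powf k : exists d, j c * f ^+ k = j d.
  have [n] := ubnP k; elim: n k => // n IHn k; rewrite ltnS => le_kn.
  have [le_mk|lt_km] := leqP m k; last first.
    exists (w ^+ (m - k) * v ^+ k).
    rewrite /c -{1}(subnK (ltnW lt_km)) exprD !rmorphM !rmorphXn /= -def_f exprMn.
    by rewrite -!mulrA [_ ^+ k * f ^+ k]mulrC.
  rewrite -(subnK le_mk) exprD fm mulrN mulr_sumr mulrN mulr_sumr.
  elim/big_rec: _ => [|i x _ [d def_d]]; first by exists 0; rewrite rmorph0 oppr0.
  have [e def_e] : exists e, j c * f ^+ (k - m + i) = j e.
    apply: IHn; apply: leq_trans le_kn.
    by rewrite -{2}(subnK le_mk) ltn_add2l.
  exists (d - p`_i * e); rewrite [RHS]rmorphB rmorphM /= -def_d -def_e opprD addrC.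
  by rewrite exprD (mulrCA (j p`_i)) (mulrCA (j p`_i)).

have [d def_d] := choice powf.
have j_inj : injective j by move=> a b /eqP; rewrite tofrac_eq => /eqP.
have d0 : d 0%N = c by apply: j_inj; rewrite -def_d mulr1.
have dd h k : d h * d k = d 0%N * d (h + k)%N.
  by apply: j_inj; rewrite !rmorphM /= d0 -!def_d exprD mulrACA -!mulrA.
have c0 : c != 0 by rewrite expf_neq0.
have vc0 : val c != 0 by apply: contraNneq c0 => vc; apply/eqP/val_inj; rewrite rmorph0.
have [||||b def_b] := @closedR (val c) (left_span (val \o d)) (val_centerC c) vc0
  _ _ _ (val (d 1%N)).
- by move=> a b; apply: left_spanD.
- move=> a; rewrite val_centerC -d0 -[_ * _]addr0; apply: left_span_add; exact: left_span0.
- by move=> a b; rewrite -d0; apply: left_spanM.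
- by rewrite -[val _]mul1r -[_ * _]addr0; apply: (left_span_add 1 1); apply: left_span0.
have cb : central b.
  move=> a; have /domR[/eqP|/eqP] : val c * (b * a - a * b) = 0.
  - by rewrite mulrBr !mulrA -def_b (val_centerC c) -mulrA -def_b val_centerC subrr.
  - by rewrite (negPf vc0).
  by rewrite subr_eq0 => /eqP.
have def_d1 : d 1%N = c * Center domR (introT (center_predP b) cb).
  by apply: val_inj; rewrite rmorphM.
exists (Center domR (introT (center_predP b) cb)).
apply: (mulfI (x := j c)); first by rewrite tofrac_eq0.
by have := def_d 1%N; rewrite expr1 => ->; rewrite def_d1 -rmorphM.
Qed.

End CenterClosed.

(** The quotient by the ideal generated by the kernel of [chi] behaves like a
    prime ring as far as products of idempotents are concerned. *)
Theorem fiber_idempotents_linked (K : closedFieldType) (R : algType K)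
    (chi : R -> K) (N : nat) (v : 'I_N.+1 -> R) (a b : R) :
  [pchar K] =i pred0 -> noncomm_domain R -> completely_closed R ->
  (forall a, exists2 c : 'I_N.+1 -> R, (forall i, central (c i)) & a = \sum_i c i * v i) ->
  central_character chi ->
  character_ideal chi (a * a - a) -> character_ideal chi (b * b - b) ->
  (forall c, character_ideal chi (a * c * b)) ->
  character_ideal chi a \/ character_ideal chi b.
Proof.
move=> charK domR closedR span_v [chi1 chiD chiM chiZ].
pose Z := center domR; pose f (z : Z) := chi (val z).
have cenv (z : Z) : central (val z) by apply: val_centerC.
have fB : zmod_morphism f.
  move=> y z; rewrite /f rmorphB /= chiD; try exact: cenv.
    by rewrite -scaleN1r chiZ ?mulN1r //; apply: cenv.
  by move=> c; rewrite mulNr mulrN (cenv z).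
have fM : monoid_morphism f.
  by split=> [|y z]; rewrite /f ?rmorph1 // rmorphM /= chiM //; apply: cenv.
pose chi' : {rmorphism Z -> K} := HB.pack f (GRing.isZmodMorphism.Build Z K f fB)
  (GRing.isMonoidMorphism.Build Z K f fM).
pose iota : {rmorphism Z -> R} := (val : Z -> R).
have idealE y : character_ideal chi y <-> fiber_ideal iota chi' y.
  split=> [] [m [z [c [z0 ->]]]].
    exists m, (fun i => Center domR (introT (center_predP (z i)) (z0 i).1)), c.
    by split=> [i|]; [exact: (z0 i).2 | apply: eq_bigr].
  by exists m, (iota \o z), c; split=> // i; split; [apply: cenv | apply: z0].
rewrite !idealE => a_idem b_idem ab0.
apply: (idempotents_linked (val_centerC (domR := domR)) val_inj _ (@fraction_of Z)
  _ domR _ charK (v := v)) => //.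
- by move=> y z /eqP; rewrite tofrac_eq => /eqP.
- exact: center_integrally_closed.
- by move=> y cy; exists (Center domR (introT (center_predP y) cy)).
- move=> y; have [c cc ->] := span_v y.
  by exists (fun i => Center domR (introT (center_predP (c i)) (cc i))).
- by move=> c; rewrite -idealE.
Qed.

(** * Straightening of monomials *)

Section Span.

Variables (K : fieldType) (R : algType K) (M : nat) (pw : 'I_M -> int -> R).

Definition mono (t : expo M) : R := \prod_(k < M) pw k (t k).

Inductive span (P : pred (expo M)) : R -> Prop :=
| span0 : span P 0
| spanA c t a : P t -> span P a -> span P (c *: mono t + a).

Lemma spanD P a b : span P a -> span P b -> span P (a + b).
Proof.
move=> Sa Sb; elim: Sa => [|c t a' Pt _ IHa]; first by rewrite add0r.
by rewrite -addrA; constructor.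
Qed.

Lemma spanZ P c a : span P a -> span P (c *: a).
Proof.
elim=> [|d t a' Pt _ IHa]; first by rewrite scaler0; constructor.
by rewrite scalerDr scalerA; constructor.
Qed.

Lemma spanN P a : span P a -> span P (- a).
Proof. by move=> Sa; rewrite -scaleN1r; apply: spanZ. Qed.

Lemma spanB P a b : span P a -> span P b -> span P (a - b).
Proof. by move=> Sa Sb; apply: spanD => //; apply: spanN. Qed.

Lemma span_mono (P : pred (expo M)) c t : P t -> span P (c *: mono t).
Proof. by move=> Pt; rewrite -[_ *: _]addr0; apply: spanA => //; apply: span0. Qed.

Lemma spanS (P Q : pred (expo M)) a : (forall t, P t -> Q t) -> span P a -> span Q a.
Proof.
move=> sPQ; elim=> [|c t b Pt _ IHb]; first exact: span0.
by apply: spanA => //; apply: sPQ.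
Qed.

Lemma span_linear (P Q : pred (expo M)) (phi : R -> R) a :
  (forall c a b, phi (c *: a + b) = c *: phi a + phi b) ->
  (forall t, P t -> span Q (phi (mono t))) -> span P a -> span Q (phi a).
Proof.
move=> phi_lin phiP; elim=> [|c t a' Pt _ IHa].
  have := phi_lin (-1) 0 0; rewrite scaler0 addr0 scaleN1r addNr => ->.
  by constructor.
by rewrite phi_lin; apply: spanD => //; apply/spanZ/phiP.
Qed.

Lemma span_lmul (P Q : pred (expo M)) b a :
  (forall t, P t -> span Q (b * mono t)) -> span P a -> span Q (b * a).
Proof.
by apply: (@span_linear _ _ ( *%R b)) => c x y; rewrite mulrDr scalerAr.
Qed.

Lemma span_mul (P Q T : pred (expo M)) a b :
  (forall t u, P t -> Q u -> span T (mono t * mono u)) ->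
  span P a -> span Q b -> span T (a * b).
Proof.
move=> PQT Sa Sb; apply: (@span_linear P T ( *%R^~ b)) => // [c x y|t Pt].
  by rewrite mulrDl scalerAl.
by apply: span_lmul Sb => u Qu; apply: PQT.
Qed.

End Span.

Lemma enum_ord_split M (k : 'I_M) : exists s1 s2 : seq 'I_M,
  [/\ index_enum 'I_M = s1 ++ k :: s2, forall i, i \in s1 -> (i < k)%N
    & forall i, i \in s2 -> (k < i)%N].
Proof.
have := mem_index_enum k.
have : pairwise (fun i k : 'I_M => (i < k)%N) (index_enum 'I_M).
  rewrite -[index_enum _]enumT -(pairwise_map (val : 'I_M -> nat) ltn) val_enum_ord.
  by rewrite -sorted_pairwise ?iota_ltn_sorted //; apply: ltn_trans.
move: (index_enum _) => s lt_s /path.splitPr def_s.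
case: def_s lt_s => s1 s2; rewrite pairwise_cat => /and3P[lt1 _ /= /andP[lt2 _]].
exists s1, s2; split=> // i; last by move/(allP lt2).
by move=> s1i; move/allrelP: lt1; apply; rewrite // mem_head.
Qed.

Section Straightening.

Variables (K : fieldType) (R : algType K) (M : nat) (kappa : {set 'I_M}).
Variables (pw : 'I_M -> int -> R) (omega : 'I_M -> nat).

Local Notation adm := (admissible_expo kappa).
Local Notation mono := (mono pw).
Local Notation span := (span pw).

Definition okexp (k : 'I_M) (z : int) := (k \in kappa) || (0 <= z).
Definition single (k : 'I_M) (z : int) : expo M := [ffun i => if i == k then z else 0].
Definition dot (c t : expo M) : int := \sum_k c k * t k.
Definition weights : expo M := [ffun k => (omega k)%:Z].
Definition wt (t : expo M) : int := dot weights t.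
Definition below (m : int) : pred (expo M) := fun t => adm t && (wt t < m).

Lemma dotDr c t u : dot c (t + u) = dot c t + dot c u.
Proof. by rewrite -big_split; apply: eq_bigr => k _; rewrite ffunE mulrDr. Qed.

Lemma dot_single c k z : dot c (single k z) = c k * z.
Proof.
rewrite /dot (bigD1 k) //= ffunE eqxx big1 ?addr0 // => i /negPf ik.
by rewrite ffunE ik mulr0.
Qed.

Lemma wtD t u : wt (t + u) = wt t + wt u. Proof. exact: dotDr. Qed.

Lemma wt_single k z : wt (single k z) = (omega k)%:Z * z.
Proof. by rewrite /wt dot_single ffunE. Qed.

Lemma adm_ok (t : expo M) k : adm t -> okexp k (t k).
Proof. by move/forallP/(_ k); rewrite /okexp; case: (k \in kappa). Qed.

Lemma ok_adm (t : expo M) : (forall k, okexp k (t k)) -> adm t.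
Proof. by move=> ok; apply/forallP=> k; have := ok k; rewrite /okexp; case: (k \in kappa). Qed.

Lemma admD t u : adm t -> adm u -> adm (t + u).
Proof.
move=> At Au; apply: ok_adm => k; move: (adm_ok k At) (adm_ok k Au).
by rewrite ffunE /okexp; case: (k \in kappa) => //=; apply: addr_ge0.
Qed.

Lemma adm_single k z : okexp k z -> adm (single k z).
Proof.
move=> ok; apply: ok_adm => i; rewrite ffunE; case: eqP => [->//|_].
by rewrite /okexp lexx orbT.
Qed.

Hypothesis omega_kappa : forall k, k \in kappa -> omega k = 0%N.
Hypothesis omega_gt0 : forall k, k \notin kappa -> (0 < omega k)%N.

Lemma wt_ge0 t : adm t -> 0 <= wt t.
Proof.
move=> At; apply: sumr_ge0 => k _; rewrite ffunE.
have := adm_ok k At; rewrite /okexp; case: (boolP (k \in kappa)) => [/omega_kappa->|_ /= tk].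
  by rewrite mul0r.
exact: mulr_ge0.
Qed.

Hypothesis pw0 : forall k, pw k 0 = 1.
Hypothesis pwD : forall k a b, okexp k a -> okexp k b -> pw k (a + b) = pw k a * pw k b.
Hypothesis pw_kappa : forall k i z w, k \in kappa -> okexp i w ->
  exists2 c : K, c != 0 & pw k z * pw i w = c *: (pw i w * pw k z).
Hypothesis pw_swap : forall i k : 'I_M, i \notin kappa -> k \notin kappa -> (k < i)%N ->
  exists2 c : K, c != 0 & exists2 a, span (below (omega k + omega i)%N) a
    & pw i 1 * pw k 1 = c *: (pw k 1 * pw i 1) + a.

Lemma mono_insert k z (t : expo M) (d : K) s1 s2 :
  index_enum 'I_M = s1 ++ k :: s2 -> k \notin s1 -> k \notin s2 ->
  okexp k z -> okexp k (t k) ->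
  pw k z * \prod_(i <- s1) pw i (t i) = d *: (\prod_(i <- s1) pw i (t i) * pw k z) ->
  pw k z * mono t = d *: mono (t + single k z).
Proof.
move=> def_e ks1 ks2 okz okt comm; rewrite /mono def_e !big_cat !big_cons /=.
rewrite mulrA comm -scalerAl -!mulrA; congr (_ *: _); congr (_ * _).
  rewrite big_seq [RHS]big_seq; apply: eq_bigr => i s1i; rewrite !ffunE.
  by case: eqP s1i ks1 => [-> ->//|_ _ _]; rewrite addr0.
rewrite mulrA -pwD // !ffunE eqxx [z + _]addrC; congr (_ * _).
rewrite big_seq [RHS]big_seq; apply: eq_bigr => i s2i; rewrite !ffunE.
by case: eqP s2i ks2 => [-> ->//|_ _ _]; rewrite addr0.
Qed.

Lemma mono_prepend k z (t : expo M) : okexp k z -> okexp k (t k) ->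
  (forall i : 'I_M, (i < k)%N -> t i = 0) -> pw k z * mono t = mono (t + single k z).
Proof.
move=> okz okt t0; have [s1 [s2 [def_e lt1 lt2]]] := enum_ord_split k.
rewrite (@mono_insert k z t 1 s1 s2) ?scale1r //.
- by apply/negP=> /lt1; rewrite ltnn.
- by apply/negP=> /lt2; rewrite ltnn.
suff -> : \prod_(i <- s1) pw i (t i) = 1 by rewrite mulr1 mul1r.
by rewrite big_seq big1 // => i /lt1 /t0 ->; rewrite pw0.
Qed.

(** The invertible variables commute with all others up to scalars, so that
    they can be inserted at their place without any correction. *)
Lemma mono_kappa k z (t : expo M) : k \in kappa -> adm t ->
  exists2 d : K, d != 0 & pw k z * mono t = d *: mono (t + single k z).
Proof.
move=> kk At; have [s1 [s2 [def_e lt1 lt2]]] := enum_ord_split k.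
have [d d0 comm] : exists2 d : K, d != 0 &
    pw k z * \prod_(i <- s1) pw i (t i) = d *: (\prod_(i <- s1) pw i (t i) * pw k z).
  elim: (s1) => [|i s [d d0 IHs]].
    by exists 1; rewrite ?oner_neq0 // big_nil mulr1 mul1r scale1r.
  have [c c0 comm] := pw_kappa z kk (adm_ok i At).
  exists (c * d); rewrite ?mulf_neq0 // big_cons mulrA comm -scalerAl -!mulrA IHs.
  by rewrite -scalerAr scalerA.
exists d => //; apply: (@mono_insert k z t d s1 s2) => //.
- by apply/negP=> /lt1; rewrite ltnn.
- by apply/negP=> /lt2; rewrite ltnn.
- by rewrite /okexp kk.
- by rewrite /okexp kk.
Qed.

(** Only weights are compared: the straightening law in this form serves all
    the orders that refine the comparison of weights. *)
Definition leads (x : expo M) (a : R) :=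
  exists2 c : K, c != 0 & span (below (wt x)) (a - c *: mono x).

Lemma below_kappa k z m a : k \in kappa -> span (below m) a -> span (below m) (pw k z * a).
Proof.
move=> kk; apply: span_lmul => t /andP[At lt_tm].
have [d d0 ->] := mono_kappa z kk At; apply: span_mono; rewrite /below.
by rewrite admD ?adm_single ?/okexp ?kk //= wtD wt_single omega_kappa // mul0r addr0.
Qed.

Lemma belowS m n a : m <= n -> span (below m) a -> span (below n) a.
Proof.
move=> le_mn; apply: spanS => t /andP[At lt_tm]; apply/andP; split=> //.
exact: lt_le_trans le_mn.
Qed.

Lemma leadsZ d x a : d != 0 -> leads x a -> leads x (d *: a).
Proof.
move=> d0 [c c0 low]; exists (d * c); first exact: mulf_neq0.
by rewrite -scalerA -scalerBr; apply: spanZ.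
Qed.

Lemma leadsD x a b : leads x a -> span (below (wt x)) b -> leads x (a + b).
Proof. by move=> [c c0 low] lowb; exists c => //; rewrite addrAC; apply: spanD. Qed.

Lemma leadsDl x a b : leads x a -> span (below (wt x)) b -> leads x (b + a).
Proof. by rewrite addrC; apply: leadsD. Qed.

Lemma leads_mono x : leads x (mono x).
Proof. by exists 1; rewrite ?oner_neq0 // scale1r subrr; constructor. Qed.

Lemma leads_span x a : adm x -> leads x a -> span (below (wt x + 1)) a.
Proof.
move=> Ax [c c0 low]; rewrite -[a](subrK (c *: mono x)); apply: spanD.
  by apply: belowS low; rewrite lerDl.
by apply: span_mono; rewrite /below Ax ltrDl.
Qed.

(** The weight of the product bounds the induction: the corrections produced by
    an exchange of variables are words of smaller weight. *)
Definition straight n := forall i t, i \notin kappa -> adm t ->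
  wt t + (omega i)%:Z < n%:Z -> leads (t + single i 1) (pw i 1 * mono t).

Lemma below_gen n m i a : straight n -> i \notin kappa -> m + (omega i)%:Z <= n%:Z ->
  span (below m) a -> span (below (m + (omega i)%:Z)) (pw i 1 * a).
Proof.
move=> st ik le_mn; apply: span_lmul => t /andP[At lt_tm].
have A' : adm (t + single i 1) by rewrite admD // adm_single // /okexp orbT.
apply: belowS (leads_span A' (st i t ik At _)).
  by rewrite wtD wt_single mulr1 addrAC lerD2r lezD1.
by apply: lt_le_trans le_mn; rewrite ltrD2r.
Qed.

Lemma below_pw n m i z a : straight n -> okexp i z -> m + (omega i)%:Z * z <= n%:Z ->
  span (below m) a -> span (below (m + (omega i)%:Z * z)) (pw i z * a).
Proof.
move=> st; rewrite /okexp; case: (boolP (i \in kappa)) => [ik _ _|ik /=].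
  by rewrite omega_kappa // mul0r addr0; apply: below_kappa.
case: z => // p _; elim: p => [|p IHp] le_mn Sa.
  by rewrite pw0 mul1r mulr0 addr0.
have def_w : m + (omega i)%:Z * p.+1 = m + (omega i)%:Z * p + (omega i)%:Z by lia.
rewrite def_w in le_mn *; rewrite -add1n PoszD pwD ?/okexp ?orbT // -mulrA.
by apply: (below_gen st ik le_mn (IHp _ Sa)); apply: le_trans le_mn; rewrite lerDl.
Qed.

Lemma below_mono n m t a : straight n -> adm t -> m + wt t <= n%:Z ->
  span (below m) a -> span (below (m + wt t)) (mono t * a).
Proof.
move=> st At; rewrite /wt /dot /mono; elim: (index_enum _) => [|i s IHs].
  by rewrite !big_nil addr0 mul1r.
rewrite !big_cons ffunE addrCA addrC -mulrA => le_mn Sa.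
apply: (below_pw st (adm_ok i At) le_mn (IHs _ Sa)).
apply: le_trans le_mn; rewrite lerDl; have := adm_ok i At; rewrite /okexp.
by case: (boolP (i \in kappa)) => [/omega_kappa->|_ /= ti]; rewrite ?mul0r // mulr_ge0.
Qed.

(** The invertible variables of [t] can be set aside, since they are exchanged
    without correction. Then, if [x_k] is the first variable of [t] and
    [k < i], the product [x_i * x_k] is replaced by a multiple of [x_k * x_i],
    which puts [x_k] at its final place, plus a correction of smaller
    weight. *)
Lemma straightS n : straight n -> straight n.+1.
Proof.
move=> st i t ik At; have [c] := ubnP #|[set k in kappa | t k != 0]|.
elim: c t At => // c IHc t At; rewrite ltnS => le_c le_n.
have [/exists_inP[k kk tk]|nok] := boolP [exists k in kappa, t k != 0].
  (* t0 is t without the invertible variable x_k. *)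
  pose t0 := t + single k (- t k).
  have okk z : okexp k z by rewrite /okexp kk.
  have At0 : adm t0 by rewrite admD // adm_single.
  have wt0 : wt t0 = wt t by rewrite wtD wt_single omega_kappa // mul0r addr0.
  have def_t : t0 + single k (t k) = t.
    apply/ffunP=> h; rewrite !ffunE; case: eqP => [->|_]; last by rewrite !addr0.
    by rewrite subrK.
  have [d d0 def_m] := mono_kappa (t k) kk At0; rewrite def_t in def_m.
  have [e e0 comm] := @pw_kappa k i (t k) 1 kk (orbT _).
  have -> : pw i 1 * mono t = (d^-1 * e^-1) *: (pw k (t k) * (pw i 1 * mono t0)).
    rewrite mulrA comm -scalerAl scalerA mulrVK ?unitfE // -mulrA def_m.
    by rewrite -scalerAr scalerA mulVf // scale1r.
  apply: leadsZ; first by rewrite mulf_neq0 ?invr_eq0.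
  have [||f f0 low] := IHc t0 At0.
  - apply: leq_trans le_c; apply/proper_card/properP; split.
      apply/subsetP=> h; rewrite !inE !ffunE => /andP[-> /=].
      by case: (h =P k) => [->|_]; rewrite ?subrr ?eqxx ?addr0.
    by exists k; rewrite !inE ?kk ?tk // !ffunE eqxx subrr eqxx andbF.
  - by rewrite wt0.
  rewrite -[pw i 1 * _](subrK (f *: mono (t0 + single i 1))) mulrDr.
  have A' : adm (t0 + single i 1) by rewrite admD // adm_single // /okexp orbT.
  apply: leadsDl; last by rewrite wtD -wt0 -wtD; apply: below_kappa.
  have [g g0 def_g] := mono_kappa (t k) kk A'; rewrite -scalerAr def_g.
  rewrite addrAC def_t; do 2!(apply: leadsZ => //); exact: leads_mono.
have tk0 k : k \in kappa -> t k = 0.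
  by move=> kk; apply: contraNeq nok => tk; apply/exists_inP; exists k.
have ok1 k : okexp k 1 by rewrite /okexp orbT.
have [nolt|] := boolP [forall k : 'I_M, (k < i)%N ==> (t k == 0)].
  rewrite mono_prepend //; first exact: leads_mono.
    exact: adm_ok.
  by move=> k lt_ki; move/forallP/(_ k)/implyP/(_ lt_ki)/eqP: nolt.
rewrite negb_forall => /existsP[k0]; rewrite negb_imply => k0P.
have [k /andP[lt_ki tk] min_k] := arg_minnP (P := fun k : 'I_M => (k < i)%N && (t k != 0)) val k0P.
have kk : k \notin kappa by apply: contra tk => /tk0->.
have tk_gt0 : 0 < t k.
  by rewrite lt_neqAle eq_sym tk; have := adm_ok k At; rewrite /okexp (negPf kk).
(* k is now the first index of the support of t, and it is not invertible. *)
pose t' := t + single k (-1).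
have def_t : t' + single k 1 = t.
  apply/ffunP=> h; rewrite !ffunE; case: eqP => [->|_]; last by rewrite !addr0.
  by rewrite subrK.
have At' : adm t'.
  apply: ok_adm => h; rewrite !ffunE; case: eqP => [->|_].
    by rewrite /okexp subr_ge0 -gtz0_ge1 tk_gt0 orbT.
  by rewrite addr0; apply: adm_ok.
have wt' : wt t = wt t' + (omega k)%:Z by rewrite -{1}def_t wtD wt_single mulr1.
have t0 (h : 'I_M) : (h < k)%N -> t h = 0.
  move=> lt_hk; apply: contraTeq (leq_trans lt_hk (leqnn k)) => th.
  by rewrite -leqNgt; apply: min_k; rewrite th (ltn_trans lt_hk).
have t'0 (h : 'I_M) : (h < k)%N -> t' h = 0.
  by move=> lt_hk; rewrite !ffunE ifN ?addr0 ?t0 // neq_ltn lt_hk.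
have mono_t : pw k 1 * mono t' = mono t by rewrite mono_prepend ?def_t //; apply: adm_ok.
have [c1 c10 [a low_a swap]] := pw_swap ik kk lt_ki.
have gt_k := omega_gt0 kk.
rewrite -mono_t mulrA swap mulrDl -scalerAl -mulrA.
have [|f f0 low] := st i t' ik At'.
  by move: le_n gt_k; rewrite wt'; lia.
apply: leadsD; last first.
  apply: (@span_linear _ _ _ _ _ _ ( *%R^~ (mono t')) a _ _ low_a) => [d x y|v /andP[Av lt_v]].
    by rewrite mulrDl scalerAl.
  have Sm : span (below (wt t' + 1)) (mono t').
    by rewrite -[mono t']scale1r; apply: span_mono; rewrite /below At' ltrDl.
  have wtv := wt_ge0 Av.
  apply: (belowS _ (below_mono st Av _ Sm)).
    by rewrite wtD wt_single wt' mulr1; lia.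
  by move: le_n; rewrite wt'; lia.
apply: leadsZ => //.
rewrite -[pw i 1 * _](subrK (f *: mono (t' + single i 1))) mulrDr.
apply: leadsDl; last first.
  rewrite wtD wt' addrAC -wtD; apply: (below_gen st kk _ low).
  by rewrite wtD wt_single mulr1; move: le_n; rewrite wt'; lia.
rewrite -scalerAr mono_prepend //.
- by rewrite addrAC def_t; apply: leadsZ => //; apply: leads_mono.
- by apply: adm_ok; rewrite admD // adm_single.
- move=> h lt_hk; rewrite ffunE t'0 // add0r ffunE ifN //.
  by rewrite neq_ltn (ltn_trans lt_hk).
Qed.

Lemma straight_all n : straight n.
Proof.
elim: n => [|n IHn]; last exact: straightS.
move=> i t _ At; have := wt_ge0 At; lia.
Qed.

Lemma leads_pw i z x a : okexp i z -> adm x -> leads x a ->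
  leads (x + single i z) (pw i z * a).
Proof.
move=> ok Ax [c c0 low]; rewrite -[a](subrK (c *: mono x)) mulrDr.
apply: leadsDl; last first.
  rewrite wtD wt_single; apply: (@below_pw (absz (wt x + (omega i)%:Z * z))) => //.
    exact: straight_all.
  exact: lez_abs.
rewrite -scalerAr; apply: leadsZ => // {c c0 a low}.
move: ok; rewrite /okexp; case: (boolP (i \in kappa)) => [ik _|ik /=].
  have [d d0 ->] := mono_kappa z ik Ax.
  by apply: leadsZ => //; apply: leads_mono.
case: z => // p _; elim: p => [|p [c c0 low]].
  have -> : x + single i 0 = x by apply/ffunP=> h; rewrite !ffunE; case: eqP; rewrite addr0.
  by rewrite pw0 mul1r; apply: leads_mono.
have Ap : adm (x + single i p) by rewrite admD // adm_single // /okexp orbT.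
rewrite -add1n PoszD pwD ?/okexp ?orbT // -mulrA.
rewrite -[pw i p * _](subrK (c *: mono (x + single i p))) mulrDr.
have -> : x + single i (1 + p%:Z) = (x + single i p) + single i 1.
  by apply/ffunP=> h; rewrite !ffunE; case: eqP => _; rewrite ?addr0 // -addrA [p%:Z + _]addrC.
apply: leadsDl; last first.
  rewrite wtD wt_single mulr1.
  apply: (@below_gen (absz (wt (x + single i p) + (omega i)%:Z))) => //.
    exact: straight_all.
  exact: lez_abs.
rewrite -scalerAr; apply: leadsZ => //.
by apply: (@straight_all (absz (wt (x + single i p) + (omega i)%:Z)).+1) => //; lia.
Qed.

Lemma leads_mul t u : adm t -> adm u -> leads (t + u) (mono t * mono u).
Proof.
move=> At Au.
have -> : t + u = u + \sum_(i <- index_enum 'I_M) single i (t i).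
  rewrite addrC; congr (_ + _); apply/ffunP=> k; rewrite sum_ffunE (bigD1 k) //= ffunE eqxx.
  by rewrite big1 ?addr0 // => h /negPf hk; rewrite ffunE eq_sym hk.
rewrite /mono -/(mono u); elim: (index_enum _) => [|i s IHs].
  by rewrite !big_nil addr0 mul1r; apply: leads_mono.
rewrite !big_cons [single _ _ + _]addrC addrA -mulrA; apply: leads_pw => //.
  exact: adm_ok.
apply: admD => //; elim: (s) => [|h s' IHs']; last first.
  by rewrite big_cons admD // adm_single // adm_ok.
by rewrite big_nil; apply: ok_adm => h; rewrite ffunE /okexp lexx orbT.
Qed.

End Straightening.

(** * Leading terms and division *)

Section LexicographicKeys.

Variable M : nat.
Implicit Types (cs : seq (expo M)) (t u : expo M).

(** A family of linear forms encodes the order that compares their values one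
    after the other. Such orders are compatible with the addition of
    exponents, and they are total if all coordinates are among the forms. *)
Definition key cs t : seqlexi int := [seq dot c t | c <- cs].

Lemma key_lt_add cs v t u : (key cs t < key cs u)%O -> (key cs (v + t) < key cs (v + u))%O.
Proof.
elim: cs => [|c cs IHcs] //=; rewrite !ltxi_cons !dotDr !lerD2l.
by case/andP=> -> /= /implyP lt_tu; apply/implyP => /lt_tu.
Qed.

Lemma key_add cs v t u : key cs t = key cs u -> key cs (v + t) = key cs (v + u).
Proof. by elim: cs => //= c cs IHcs [] ct /IHcs ->; rewrite !dotDr ct. Qed.

Lemma key_le_add cs v t u : (key cs t <= key cs u)%O -> (key cs (v + t) <= key cs (v + u))%O.
Proof.
rewrite le_eqVlt => /predU1P[/(key_add v)->//|/(key_lt_add v)]; exact: ltW.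
Qed.

Lemma key_cons_lt c cs t u : dot c t < dot c u -> (key (c :: cs) t < key (c :: cs) u)%O.
Proof. by move=> lt_tu; rewrite ltxi_cons ltW //= leNgt lt_tu. Qed.

Lemma key_cons_le c cs t u : (key (c :: cs) t <= key (c :: cs) u)%O -> dot c t <= dot c u.
Proof. by rewrite lexi_cons => /andP[]. Qed.

Definition coordinates : seq (expo M) := [seq single k 1 | k <- enum 'I_M].

Lemma dot_coordinate k t : dot (single k 1) t = t k.
Proof.
rewrite /dot (bigD1 k) //= ffunE eqxx mul1r big1 ?addr0 // => i /negPf ik.
by rewrite ffunE ik mul0r.
Qed.

Lemma dot_opp k t : dot (single k (-1)) t = - t k.
Proof.
rewrite /dot (bigD1 k) //= ffunE eqxx mulN1r big1 ?addr0 // => i /negPf ik.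
by rewrite ffunE ik mul0r.
Qed.

Lemma key_inj cs t u : key (cs ++ coordinates) t = key (cs ++ coordinates) u -> t = u.
Proof.
move=> /eqP; rewrite /key !map_cat eqseq_cat ?size_map // => /andP[_].
rewrite /coordinates -!map_comp => /eqP/eq_in_map eq_tu.
apply/ffunP=> k; have := eq_tu k; rewrite -enumT mem_enum => /(_ isT).
by rewrite /= !dot_coordinate.
Qed.

End LexicographicKeys.

(** The lexicographic order on lists of natural numbers of a given length is
    well-founded. *)
Lemma lex_ind n (P : seq int -> Prop) :
  (forall s, size s = n -> all (fun z => 0 <= z) s ->
    (forall s', size s' = n -> all (fun z => 0 <= z) s' ->
      ((s' : seqlexi int) < s)%O -> P s') -> P s) ->
  forall s, size s = n -> all (fun z => 0 <= z) s -> P s.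
Proof.
elim: n P => [|n IHn] P step [|z s] //= sz pos.
  by apply: step => // -[|] // _ _; rewrite ltxx.
case: sz => sz; case/andP: pos => pos_z pos.
case: z pos_z => // m _; have [b] := ubnP m; elim: b m s sz pos => // b IHb m s sz pos.
rewrite ltnS => le_mb.
apply: (IHn (fun s => P (Posz m :: s))) sz pos => {}s sz pos IHs.
apply: step => /= [||[|z s'] //= [sz'] /andP[pos_z pos']]; rewrite ?sz ?pos //.
case: z pos_z => // m' _; rewrite ltxi_cons.
have [lt_m'm _|lt_mm'|eq_m'm] := ltngtP m' m.
- by apply: IHb => //; apply: leq_trans le_mb.
- by rewrite lez_nat leqNgt lt_mm'.
- by rewrite eq_m'm lexx /= => /IHs; apply.
Qed.

Section LeadingTerms.

Variables (K : fieldType) (R : algType K) (M : nat) (kappa : {set 'I_M}).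
Variables (pw : 'I_M -> int -> R) (omega : 'I_M -> nat).

Local Notation adm := (admissible_expo kappa).
Local Notation mono := (mono pw).
Local Notation span := (span pw).
Local Notation wt := (wt omega).
Local Notation below := (below kappa omega).

Hypothesis mul_leads : forall t u : expo M, adm t -> adm u ->
  leads kappa pw omega (t + u) (mono t * mono u).
Hypothesis wt_ge0 : forall t : expo M, adm t -> 0 <= wt t.
Hypothesis span_adm : forall a, span adm a.
Hypothesis free_mono : forall (ts : seq (expo M)) (c : expo M -> K),
  uniq ts -> all adm ts -> \sum_(t <- ts) c t *: mono t = 0 ->
  forall t, t \in ts -> c t = 0.

Lemma span_normal (P : pred (expo M)) a : span P a ->
  exists (ts : seq (expo M)) (c : expo M -> K),
    [/\ uniq ts, all P ts & a = \sum_(t <- ts) c t *: mono t].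
Proof.
elim=> [|d t {}a Pt _ [ts [c [Uts Pts ->]]]].
  by exists [::], (fun=> 0); split; rewrite ?big_nil.
pose c' u := if u == t then (if t \in ts then d + c t else d) else c u.
have c'E s : t \notin s -> \sum_(u <- s) c' u *: mono u = \sum_(u <- s) c u *: mono u.
  move=> ts'; rewrite big_seq [RHS]big_seq; apply: eq_bigr => u su.
  by rewrite /c' ifN //; apply: contraNneq ts' => <-.
have [tts|tts] := boolP (t \in ts); last first.
  exists (t :: ts), c'; split; rewrite /= ?tts ?Pt // big_cons c'E //.
  by rewrite /c' eqxx (negPf tts).
exists ts, c'; split=> //.
have tr : t \notin rem t ts by rewrite mem_rem_uniq // inE eqxx.
rewrite !(perm_big _ (perm_to_rem tts)) !big_cons /= c'E // /c' eqxx tts.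
by rewrite scalerDl addrA.
Qed.

Lemma span_supp (P : pred (expo M)) (t : expo M) c : (forall u, P u -> adm u) -> adm t ->
  span P (c *: mono t) -> c != 0 -> P t.
Proof.
move=> sPA At /span_normal[ts [d [Uts Pts def_t]]] c0.
apply/negPn/negP=> nPt; case/eqP: c0.
have tts : t \notin ts by apply: contra nPt => /(allP Pts).
pose d' u := if u == t then - c else d u.
have := @free_mono (t :: ts) d' _ _ _ t (mem_head _ _).
rewrite /d' eqxx => /(_ _ _ _)/eqP; rewrite oppr_eq0 => H; apply/eqP; apply: H => /=.
- by rewrite tts.
- by rewrite At; apply: sub_all Pts.
rewrite big_cons eqxx scaleNr def_t addrC; apply/eqP; rewrite subr_eq0; apply/eqP.
rewrite big_seq [RHS]big_seq; apply: eq_bigr => u uts.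
by rewrite ifN //; apply: contraNneq tts => <-.
Qed.

Lemma normal_supp (P : pred (expo M)) ts (c : expo M -> K) :
  (forall u, P u -> adm u) -> uniq ts -> all adm ts ->
  span P (\sum_(t <- ts) c t *: mono t) ->
  forall t, t \in ts -> c t != 0 -> P t.
Proof.
move=> sPA Uts Ats Sa t tts ct0.
pose Q u := P u || (adm u && (u \in rem t ts)).
suff: Q t by rewrite /Q mem_rem_uniq // inE eqxx andbF orbF.
apply: (span_supp (c := c t)) => // [u /orP[/sPA|/andP[]]//||]; first exact: (allP Ats).
move: Sa; rewrite (perm_big _ (perm_to_rem tts)) big_cons /= => Sa.
rewrite -[c t *: _](addrK (\sum_(u <- rem t ts) c u *: mono u)).
apply: spanB; first by apply: spanS Sa => u Pu; rewrite /Q Pu.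
rewrite big_seq; elim/big_rec: _ => [|u a ur Sa']; first exact: span0.
by apply: spanA => //; rewrite /Q (allP Ats) ?(mem_rem ur) ?ur ?orbT.
Qed.

(** The monomials that occur in [a] are the exponents that satisfy every
    predicate [Q] whose span contains [a]. *)
Lemma span_of_supp (P : pred (expo M)) a :
  (forall t, (forall Q : pred (expo M), (forall u, Q u -> adm u) -> span Q a -> Q t) -> P t) ->
  span P a.
Proof.
move=> supp_P; have [ts [c [Uts Ats def_a]]] := span_normal (span_adm a).
rewrite def_a big_seq; elim/big_rec: _ => [|t b tts Sb]; first exact: span0.
have [->|ct0] := eqVneq (c t) 0; first by rewrite scale0r add0r.
apply: spanA => //; apply: supp_P => Q sQA; rewrite def_a => SQ.
exact: normal_supp SQ t tts ct0.
Qed.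

(** Leading terms form a relation rather than a function: a single element is
    considered for several orders, and its leading exponents are compared
    through the supports ([leading_supp]). *)
Definition leading_term cs (a : R) (t : expo M) :=
  adm t /\ exists2 c : K, c != 0 &
    span (fun u => adm u && (key cs u < key cs t)%O) (a - c *: mono t).

Definition upto cs (t : expo M) : pred (expo M) :=
  fun u => adm u && (key cs u <= key cs t)%O.

Lemma leading_upto cs a t : leading_term cs a t -> span (upto cs t) a.
Proof.
move=> [At [c _ low]]; rewrite -[a](subrK (c *: mono t)); apply: spanD.
  by apply: spanS low => u /andP[Au lt_ut]; rewrite /upto Au ltW.
by apply: span_mono; rewrite /upto At lexx.
Qed.

Lemma leading_supp cs (P : pred (expo M)) a t : (forall u, P u -> adm u) ->
  leading_term cs a t -> span P a -> P t.
Proof.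
move=> sPA [At [c c0 low]] Sa.
pose Q u := P u || (adm u && (key cs u < key cs t)%O).
suff: Q t by rewrite /Q ltxx andbF orbF.
apply: (span_supp _ At _ c0) => [u /orP[/sPA|/andP[]]//|].
rewrite -[c *: _](subKr a); apply: spanB.
  by apply: spanS Sa => u Pu; rewrite /Q Pu.
by apply: spanS low => u lt_ut; rewrite /Q lt_ut orbT.
Qed.

Lemma leading_neq0 cs a t : leading_term cs a t -> a != 0.
Proof.
move=> lta; apply: contraTneq isT => a0.
have /= := @leading_supp cs pred0 a t _ lta; rewrite a0 => -> //.
exact: span0.
Qed.

Lemma leading_uniq cs a t u : leading_term (cs ++ coordinates M) a t ->
  leading_term (cs ++ coordinates M) a u -> t = u.
Proof.
move=> lt_t lt_u; apply: (@key_inj _ cs); apply/le_anti.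
have sub v w : upto (cs ++ coordinates M) v w -> adm w by case/andP.
have /andP[_ ->] := leading_supp (sub u) lt_t (leading_upto lt_u).
by have /andP[_ ->] := leading_supp (sub t) lt_u (leading_upto lt_t).
Qed.

Lemma leading_exists cs a : a != 0 -> exists t, leading_term (cs ++ coordinates M) a t.
Proof.
have [ts [c [Uts Ats ->]]] := span_normal (span_adm a).
have [n] := ubnP (size ts); elim: n ts Uts Ats => // n IHn ts Uts Ats; rewrite ltnS => sz nz.
have [t tts max_t] : exists2 t, t \in ts & forall u, u \in ts ->
    (key (cs ++ coordinates M) u <= key (cs ++ coordinates M) t)%O.
  case: (ts) nz => [|t0 s _]; first by rewrite big_nil eqxx.
  elim: s t0 => [|u s IHs] t0; first by exists t0 => [|u]; rewrite inE // => /eqP ->.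
  have [t tts max_t] := IHs t0.
  have [le_ut|/ltW le_tu] := leP (key (cs ++ coordinates M) u) (key (cs ++ coordinates M) t).
    exists t => [|v]; first by move: tts; rewrite !inE => /orP[]->; rewrite ?orbT.
    rewrite !inE => /or3P[/eqP->|/eqP->|vs] //; apply: max_t; rewrite inE ?eqxx ?vs ?orbT //.
  exists u => [|v]; first by rewrite !inE eqxx orbT.
  rewrite !inE => /or3P[/eqP->|/eqP->|vs] //; apply: le_trans le_tu; apply: max_t.
    by rewrite mem_head.
  by rewrite inE vs orbT.
have Ur : uniq (rem t ts) by rewrite rem_uniq.
have Ar : all adm (rem t ts) by apply/allP=> u /mem_rem; apply: (allP Ats).
rewrite (perm_big _ (perm_to_rem tts)) big_cons /= in nz *.
have [ct0|ct] := eqVneq (c t) 0.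
  rewrite ct0 scale0r add0r in nz *; apply: IHn => //.
  by rewrite size_rem //; case: (ts) tts sz => //= x s _; rewrite ltnS.
exists t; split; first exact: (allP Ats).
exists (c t) => //; rewrite addrAC subrr add0r.
rewrite big_seq; elim/big_rec: _ => [|u b ur Sb]; first exact: span0.
apply: spanA => //; rewrite (allP Ar) //= lt_neqAle max_t ?(mem_rem ur) // andbT.
by apply/eqP=> /key_inj eq_ut; move: ur; rewrite eq_ut mem_rem_uniq // inE eqxx.
Qed.

Local Notation keys cs := (weights omega :: cs).

Lemma below_key cs t u : below (wt t) u -> adm u && (key (keys cs) u < key (keys cs) t)%O.
Proof. by case/andP=> -> lt_ut; rewrite key_cons_lt. Qed.

(** The weight comes first among the keys, so that the corrections of
    the straightening law are below the product of the leading monomials. *)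
Lemma leading_mul cs a b t u : leading_term (keys cs) a t ->
  leading_term (keys cs) b u -> leading_term (keys cs) (a * b) (t + u).
Proof.
move=> [At [c c0 la]] [Au [d d0 lb]].
have Atu : adm (t + u) by apply: admD.
split=> //; have [e e0 lm] := mul_leads At Au.
exists (c * d * e); first by rewrite !mulf_neq0.
have le_mul v w : adm v -> adm w -> span (upto (keys cs) (v + w)) (mono v * mono w).
  move=> Av Aw; have [f _ lf] := mul_leads Av Aw.
  rewrite -[_ * _](subrK (f *: mono (v + w))); apply: spanD.
    by apply: spanS lf => x /below_key -/(_ cs)/andP[Ax ltx]; rewrite /upto Ax ltW.
  by apply: span_mono; rewrite /upto admD //= lexx.
have lt_mul v w : adm v -> adm w -> (key (keys cs) (v + w) < key (keys cs) (t + u))%O ->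
    span (fun x => adm x && (key (keys cs) x < key (keys cs) (t + u))%O) (mono v * mono w).
  move=> Av Aw lt_vw; apply: spanS (le_mul v w Av Aw) => x /andP[-> /= lex].
  exact: le_lt_trans lt_vw.
have -> : a * b - (c * d * e) *: mono (t + u) =
    (a - c *: mono t) * b + c *: mono t * (b - d *: mono u)
    + (c * d) *: (mono t * mono u - e *: mono (t + u)).
  rewrite mulrBl mulrBr addrA subrK -!scalerAl -!scalerAr scalerBr !scalerA.
  by rewrite addrA subrK.
have Sb : span (upto (keys cs) u) b by apply: leading_upto; split=> //; exists d.
apply: spanD; first apply: spanD.
- apply: span_mul la Sb => v w /andP[Av lt_v] /andP[Aw le_w].
  apply: lt_mul => //; apply: (@lt_le_trans _ _ (key (keys cs) (t + w))).
    by rewrite ![_ + w]addrC; apply: key_lt_add.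
  exact: key_le_add.
- rewrite -scalerAl; apply/spanZ/(span_lmul _ lb) => w /andP[Aw lt_w].
  by apply: lt_mul => //; apply: key_lt_add.
- by apply/spanZ/(spanS _ lm) => x; apply: below_key.
Qed.

Theorem leading_term_domain : noncomm_domain R.
Proof.
move=> a b ab0; have [->|a0] := eqVneq a 0; first by left.
have [->|b0] := eqVneq b 0; first by right.
have [t la] := leading_exists (keys [::]) a0; have [u lb] := leading_exists (keys [::]) b0.
by have := leading_neq0 (leading_mul la lb); rewrite ab0 eqxx.
Qed.

Lemma leading_exp cs a t n : leading_term (keys cs) a t ->
  leading_term (keys cs) (a ^+ n.+1) (t *+ n.+1).
Proof.
move=> la; elim: n => [|n IHn] //.
by rewrite exprS mulrS; apply: leading_mul.
Qed.

Lemma int_archimedean (a b c : int) : (forall n : nat, a * n.+1 <= b * n.+1 + c) -> a <= b.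
Proof.
move=> le_n; rewrite leNgt; apply/negP=> lt_ba.
(* Any n with n + 1 greater than c refutes b < a. *)
have := le_n (absz c); nia.
Qed.

Section Division.

Variables (c : R) (W : R -> Prop).
Hypotheses (c0 : c != 0) (WD : forall a b, W a -> W b -> W (a + b)).
Hypotheses (Wc : forall a, W (c * a)).
Hypothesis (WM : forall a b, W a -> W b -> exists2 d, W d & a * b = c * d).

Lemma scaled_order_exp y n : W y -> exists2 d, W d & y ^+ n.+1 = c ^+ n * d.
Proof.
move=> Wy; elim: n => [|n [d Wd def_d]]; first by exists y; rewrite ?mul1r.
have [e We def_e] := WM Wd Wy; exists e => //.
by rewrite exprSr def_d -mulrA def_e mulrA exprSr.
Qed.

Let main := keys (coordinates M).
Let side k := keys (single k (-1) :: coordinates M).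

(** The quotient [d] does not depend on the order, so that the leading
    exponents for several orders satisfy the same linear relation and can be
    compared with each other. *)
Lemma scaled_order_leading y n : W y -> y != 0 -> exists2 d, d != 0 &
  forall cs ty tc, leading_term (keys cs ++ coordinates M) y ty ->
    leading_term (keys cs ++ coordinates M) c tc ->
  exists2 td, leading_term (keys cs ++ coordinates M) d td & ty *+ n.+2 = tc *+ n.+1 + td.
Proof.
move=> Wy y0; have [d Wd def_d] := scaled_order_exp n.+1 Wy.
have yn0 : y ^+ n.+2 != 0.
  by have [t lty] := leading_exists (keys [::]) y0; apply: leading_neq0 (leading_exp n.+1 lty).
have d0 : d != 0 by apply: contraNneq yn0 => d0; rewrite def_d d0 mulr0.
exists d => // cs ty tc lty ltc; have [td ltd] := leading_exists (keys cs) d0.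
exists td => //; apply: (@leading_uniq (keys cs) _ _ _ (leading_exp n.+1 lty)).
by rewrite def_d; apply: leading_mul (leading_exp n ltc) ltd.
Qed.

(** Both orders start with the weight: their leading terms have the same weight,
    and the second one minimises the exponent of [k] among the terms of this
    weight. *)
Lemma wt_side k a t u : leading_term main a t -> leading_term (side k) a u ->
  wt u = wt t /\ u k <= t k.
Proof.
move=> ltt ltu.
have sub cs v w : upto cs v w -> adm w by case/andP.
have /andP[_ le_tu] := leading_supp (@sub _ u) ltt (leading_upto ltu).
have /andP[_ le_ut] := leading_supp (@sub _ t) ltu (leading_upto ltt).
have wt_ut : wt u = wt t.
  by apply: le_anti; rewrite (key_cons_le le_tu) (key_cons_le le_ut).
split=> //; move: le_tu; rewrite lexi_cons -![dot _ _]/(wt _) wt_ut lexx /= => /key_cons_le.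
by rewrite !dot_opp lerN2.
Qed.

Lemma expoE (t : expo M) n k : (t *+ n) k = t k * n%:Z.
Proof. by rewrite ffunMnE -mulr_natr natz. Qed.

(** The exponent of [d] is nonnegative; dividing the relation between leading
    exponents by a large [n] leaves [tc k <= ty k]. *)
Lemma quotient_adm y ty tc : W y -> leading_term main y ty ->
  leading_term main c tc -> adm (ty - tc).
Proof.
move=> Wy lty ltc; apply: ok_adm => k; rewrite /okexp.
case: (boolP (k \in kappa)) => //= kk; rewrite !ffunE subr_ge0.
apply: (@int_archimedean _ _ (ty k)) => n.
have [d d0 /(_ [::] ty tc lty ltc)[td [Atd _] /ffunP/(_ k)]] :=
  scaled_order_leading n Wy (leading_neq0 lty).
rewrite expoE ffunE expoE; have := adm_ok k Atd; rewrite /okexp (negPf kk) /=; lia.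
Qed.

(** The smallest exponent of [k] in [d] is at most its exponent in the main
    leading term of [d]; divided by a large [n], this compares the
    corresponding differences for [y] and [c]. *)
Lemma quotient_bound y ty tc sy sc k : W y -> leading_term main y ty -> leading_term main c tc ->
  leading_term (side k) y sy -> leading_term (side k) c sc -> sy k - sc k <= ty k - tc k.
Proof.
move=> Wy lty ltc lsy lsc.
apply: (@int_archimedean _ _ (ty k - sy k)) => n.
have [d d0 Hd] := scaled_order_leading n Wy (leading_neq0 lty).
have [td ltd /ffunP/(_ k)] := Hd [::] ty tc lty ltc.
have [sd lsd /ffunP/(_ k)] := Hd [:: single k (-1)] sy sc lsy lsc.
have [_] := wt_side ltd lsd.
rewrite !(expoE, ffunE).
have -> : n.+2%:Z = n.+1%:Z + 1 by lia.
by move: (sy k) (sc k) (sd k) (ty k) (tc k) (td k) => *; lia.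
Qed.

(** The exponents of the invertible variables have no lower bound in general;
    [b] provides one, which makes the division terminate. Terms of smaller
    weight are left to the induction on the weight. *)
Definition top_above (n : int) (b : expo M) : pred (expo M) :=
  fun u => adm u && ((wt u < n) || (wt u == n) && [forall k in kappa, b k <= u k]).

(** The quotient of the leading monomials of [y] and [c] is a monomial of [R] by
    [quotient_adm], so that the leading term of [y] can be cancelled;
    [quotient_bound] shows that this preserves the lower bound [b]. *)
Lemma division_step n b y : W y -> y != 0 -> span (top_above n b) y ->
  (exists2 t, leading_term main y t & wt t = n) ->
  exists a, [/\ W (y - c * a), span (top_above n b) (y - c * a)
    & forall t u, leading_term main y t -> leading_term main (y - c * a) u ->
      (key main u < key main t)%O].
Proof.
move=> Wy y0 Sy [t lty wt_t].
have [tc ltc] := leading_exists (keys [::]) c0.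
pose u := t - tc; have Au : adm u := quotient_adm Wy lty ltc.
have ltu : leading_term main (mono u) u.
  by split=> //; exists 1; rewrite ?oner_neq0 // scale1r subrr; apply: span0.
have [_ [e e0 low_y]] := lty.
have def_t : tc + u = t by rewrite addrC subrK.
have [At [f f0 low_c]] := leading_mul ltc ltu; rewrite def_t in low_c At.
pose a := (e / f) *: mono u; exists a.
have ca : c * a = (e / f) *: (c * mono u) by rewrite -scalerAr.
have low : span (fun v => adm v && (key main v < key main t)%O) (y - c * a).
  have -> : y - c * a = (y - e *: mono t) - (e / f) *: (c * mono u - f *: mono t).
    by rewrite ca scalerBr scalerA divfK // opprB addrA subrK.
  by apply: spanB => //; apply: spanZ.
have Snc : span (top_above n b) (c * a).
  rewrite ca; apply: spanZ.
  pose Pc (v : expo M) := [&& adm v, wt v <= wt tc &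
    (wt v == wt tc) ==> [forall k in kappa, b k <= v k + u k]].
  have Sc : span Pc c.
    apply: span_of_supp => v supp_v.
    have sub cs w x : upto cs w x -> adm x by case/andP.
    have /andP[Av le_v] := supp_v _ (@sub _ tc) (leading_upto ltc).
    rewrite /Pc Av (key_cons_le le_v) /=; apply/implyP=> /eqP wt_v.
    apply/forall_inP=> k kk.
    have [sc lsc] := leading_exists (keys [:: single k (-1)]) c0.
    have [sy lsy] := leading_exists (keys [:: single k (-1)]) y0.
    have [wt_sc _] := wt_side ltc lsc; have [wt_sy _] := wt_side lty lsy.
    have /andP[_] := supp_v _ (@sub _ sc) (leading_upto lsc).
    rewrite lexi_cons -![dot _ _]/(wt _) wt_sc wt_v lexx /= => /key_cons_le.
    rewrite !dot_opp lerN2 => le_sc.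
    have top_adm w : top_above n b w -> adm w by case/andP.
    have /andP[_] := leading_supp top_adm lsy Sy.
    rewrite wt_sy wt_t ltxx eqxx /= => /forall_inP/(_ k kk) le_b.
    have := quotient_bound Wy lty ltc lsy lsc.
    have -> : u k = t k - tc k by rewrite !ffunE.
    by move: (sy k) (sc k) (t k) (tc k) (b k) (v k) le_sc le_b => *; lia.
  apply: (@span_linear _ _ _ _ Pc _ ( *%R^~ (mono u))) Sc => [d x z|v /and3P[Av le_v bv]].
    by rewrite mulrDl scalerAl.
  have [d d0 lowv] := mul_leads Av Au.
  have wt_u : wt tc + wt u = n by rewrite -wtD def_t.
  rewrite -[_ * _](subrK (d *: mono (v + u))); apply: spanD.
    apply: spanS lowv => w /andP[Aw lt_w]; rewrite /top_above Aw.
    by rewrite (lt_le_trans lt_w) // wtD -wt_u lerD2r.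
  apply: span_mono; rewrite /top_above admD //= wtD -wt_u ltrD2r (inj_eq (addIr _)).
  move: le_v bv; rewrite le_eqVlt => /orP[->|-> //] /= bv; rewrite orbC.
  apply/orP; left; apply/forall_inP=> k kk; rewrite ffunE.
  exact: (forall_inP bv).
have ty_uniq t' : leading_term main y t' -> t' = t.
  by move=> lty'; apply: (leading_uniq (cs := keys [::])) lty.
split; first by rewrite -mulrN; apply: WD.
  exact: spanB.
move=> t' v /ty_uniq-> lv.
suff /andP[] : adm v && (key main v < key main t)%O by [].
by apply: (leading_supp _ lv low) => w /andP[].
Qed.

(** The division is by induction on the weight, and for a given weight by
    lexicographic induction on the exponents, counted from the lower bound
    [b]. *)
Lemma scaled_order_division y : W y -> exists a, y = c * a.
Proof.
have [tc ltc] := leading_exists (keys [::]) c0.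
suff H (n : nat) z : W z -> span (fun u => adm u && (wt u < n%:Z)) z -> exists a, z = c * a.
  move=> Wy; have [->|y0] := eqVneq y 0; first by exists 0; rewrite mulr0.
  have [t lty] := leading_exists (keys [::]) y0.
  apply: (H (absz (wt t)).+1 y Wy).
  apply: spanS (leading_upto lty) => u /andP[-> /key_cons_le] /=.
  by rewrite -![dot _ _]/(wt _); lia.
elim: n z => [|n IHn] z Wz Sz.
  exists 0; rewrite mulr0; apply/eqP/negPn/negP=> z0.
  have [t ltt] := leading_exists (keys [::]) z0.
  have /andP[At] : adm t && (wt t < 0).
    by apply: (leading_supp _ ltt Sz) => u /andP[].
  by have := wt_ge0 At; lia.
have [b Sb] : exists b, span (top_above n b) z.
  have [ts [d [Uts Ats ->]]] := span_normal Sz.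
  (* A crude lower bound for all the exponents that occur in z. *)
  exists [ffun k => - \sum_(t <- ts) `|t k|].
  rewrite big_seq; elim/big_rec: _ => [|t a tts Sa]; first exact: span0.
  apply: spanA => //; have /andP[At lt_t] := allP Ats t tts.
  rewrite /top_above At /=; have [//|/eqP wt_t] := ltP (wt t) n.
  have -> /= : wt t == n by move: lt_t wt_t; lia.
  apply/forall_inP=> k _; rewrite ffunE (perm_big _ (perm_to_rem tts)) big_cons /=.
  have : 0 <= \sum_(u <- rem t ts) `|u k| by apply: sumr_ge0.
  by move: (\sum_(u <- _) _) => x; lia.
(* The exponents of the other variables are bounded below by 0. *)
pose bnd (k : 'I_M) := if k \in kappa then b k else 0.
pose low_exp (t : expo M) : seq int := [seq t k - bnd k | k <- enum 'I_M].
suff main_ind s : size s = M -> all (fun z => 0 <= z) s ->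
    forall y, W y -> span (top_above n b) y ->
      (forall t, leading_term main y t -> wt t = n -> low_exp t = s) -> exists a, y = c * a.
  have [->|z0] := eqVneq z 0; first by exists 0; rewrite mulr0.
  have [t ltt] := leading_exists (keys [::]) z0.
  have top_adm w : top_above n b w -> adm w by case/andP.
  have /andP[At /orP[lt_n|/andP[/eqP eq_n bt]]] := leading_supp top_adm ltt Sb.
    apply: IHn => //; apply: spanS (leading_upto ltt) => u /andP[-> /key_cons_le].
    by move/le_lt_trans; apply.
  apply: (main_ind (low_exp t)) Wz Sb _; rewrite ?size_map -?enumT ?size_enum_ord //.
    apply/allP=> _ /mapP[k _ ->]; rewrite subr_ge0 /bnd.
    have := adm_ok k At; rewrite /okexp; case: (boolP (k \in kappa)) => //= kk _.
    exact: (forall_inP bt).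
  by move=> u ltu _; rewrite (leading_uniq (cs := keys [::]) ltu ltt).
move: s; apply: lex_ind => s sz_s pos_s IHs {}y Wy Sy def_s.
have [->|y0] := eqVneq y 0; first by exists 0; rewrite mulr0.
have [t ltt] := leading_exists (keys [::]) y0.
have top_adm w : top_above n b w -> adm w by case/andP.
have /andP[At /orP[lt_n|/andP[/eqP eq_n bt]]] := leading_supp top_adm ltt Sy.
  apply: IHn => //; apply: spanS (leading_upto ltt) => u /andP[-> /key_cons_le].
  by move/le_lt_trans; apply.
have [|a [Wya Sya lt_ya]] := division_step Wy y0 Sy; first by exists t.
suff [a' def_a'] : exists a', y - c * a = c * a'.
  by exists (a + a'); rewrite mulrDr -def_a' addrC subrK.
have [->|ya0] := eqVneq (y - c * a) 0; first by exists 0; rewrite mulr0.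
have [u ltu] := leading_exists (keys [::]) ya0.
have /andP[Au /orP[lt_un|/andP[/eqP eq_un bu]]] := leading_supp top_adm ltu Sya.
  apply: IHn => //; apply: spanS (leading_upto ltu) => v /andP[-> /key_cons_le].
  by move/le_lt_trans; apply.
apply: (IHs (low_exp u)) Wya Sya _; rewrite ?size_map -?enumT ?size_enum_ord //.
- apply/allP=> _ /mapP[k _ ->]; rewrite subr_ge0 /bnd.
  have := adm_ok k Au; rewrite /okexp; case: (boolP (k \in kappa)) => //= kk _.
  exact: (forall_inP bu).
- rewrite -(def_s t ltt eq_n); have := lt_ya t u ltt ltu.
  rewrite ltxi_cons -![dot _ _]/(wt _) eq_n eq_un lexx /=.
  move/(key_lt_add (- [ffun k => bnd k])).
  have key_low v : key (coordinates M) (- [ffun k => bnd k] + v) = low_exp v.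
    rewrite /key /coordinates -map_comp; apply: eq_map => k.
    by rewrite /= dot_coordinate !ffunE addrC.
  by rewrite !key_low.
- by move=> v ltv _; rewrite (leading_uniq (cs := keys [::]) ltv ltu).
Qed.

End Division.

Theorem leading_term_completely_closed : completely_closed R.
Proof. by move=> c W _ c0 WD Wc WM a; apply: scaled_order_division. Qed.

End LeadingTerms.

(** * The q-binomial theorem in skew extensions *)

Section QBinomial.

Variables (C : comNzRingType) (q : C).

Fixpoint qbin_rec (n k : nat) : C :=
  match n, k with
  | _, 0%N => 1
  | 0%N, _.+1 => 0
  | n1.+1, k1.+1 => qbin_rec n1 k1.+1 + q ^+ (n1 - k1) * qbin_rec n1 k1
  end.
(** The definition is locked, since the recursion on [n] would otherwise be
    unfolded inside sums. *)
Definition qbin := locked qbin_rec.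

Lemma qbin0 n : qbin n 0 = 1. Proof. by rewrite /qbin -lock; case: n. Qed.

Lemma qbinS n k : qbin n.+1 k.+1 = qbin n k.+1 + q ^+ (n - k) * qbin n k.
Proof. by rewrite /qbin -lock. Qed.

Lemma qbin0S k : qbin 0 k.+1 = 0.
Proof. by rewrite /qbin -lock. Qed.

Lemma qbin_small n k : (n < k)%N -> qbin n k = 0.
Proof.
elim: n k => [|n IHn] [|k] //; rewrite ?qbin0S // ltnS => lt_nk.
by rewrite qbinS !IHn ?mulr0 ?addr0 // ltnW.
Qed.

(** This relation replaces the quotient of q-factorials, which makes no sense
    at a root of unity; from [qbin q n 0 = 1] on, it kills the intermediate
    coefficients one after the other if [q] is a primitive root of unity of
    order [n]. *)
Lemma qbin_ratio n k : (k <= n)%N ->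
  (1 - q ^+ k.+1) * qbin n k.+1 = (1 - q ^+ (n - k)) * qbin n k.
Proof.
elim: n k => [|n IHn] k.
  by case: k => // _; rewrite (qbin_small (ltnSn 0)) subrr mulr0 mul0r.
case: k => [_|k].
  rewrite qbinS !qbin0 mulrDr IHn // qbin0 !subn0 !mulr1 expr1 exprS; ring.
rewrite ltnS => le_kn; rewrite qbinS; have [->|ne_kn] := eqVneq k n.
  by rewrite !(qbin_small (ltnSn _), qbin_small (leqnSn _)) subnn subrr mul0r !mulr0 addr0 mulr0.
have lt_kn : (k < n)%N by rewrite ltn_neqAle ne_kn.
have e1 := IHn k.+1 lt_kn; have e2 := IHn k (ltnW lt_kn).
rewrite mulrDr e1 qbinS subSS mulrDr [_ * (q ^+ (n - k) * _)]mulrCA -e2.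
have -> : (n - k = (n - k.+1).+1)%N by rewrite subnSK.
rewrite !exprSr; ring.
Qed.

End QBinomial.

Lemma rmorph_qbin (C D : comNzRingType) (f : {rmorphism C -> D}) q n k :
  f (qbin q n k) = qbin (f q) n k.
Proof.
elim: n k => [|n IHn] [|k]; rewrite ?qbin0 ?rmorph1 ?qbin0S ?rmorph0 //.
by rewrite !qbinS rmorphD rmorphM rmorphXn !IHn.
Qed.

Lemma qbin_root_of_unity (K : fieldType) (q : K) l k :
  (forall i, (0 < i < l)%N -> q ^+ i != 1) -> q ^+ l = 1 -> (0 < k < l)%N -> qbin q l k = 0.
Proof.
move=> q_prim ql; elim: k => // -[_|k IHk] /andP[_ lt_kl].
  have := qbin_ratio q (leq0n l); rewrite subn0 ql subrr mul0r => /eqP.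
  by rewrite mulf_eq0 subr_eq0 eq_sym (negPf (q_prim _ _)) ?lt_kl // => /eqP.
have := qbin_ratio q (ltnW (ltnW lt_kl)); rewrite IHk ?(ltnW lt_kl) // mulr0 => /eqP.
by rewrite mulf_eq0 subr_eq0 eq_sym (negPf (q_prim _ _)) ?lt_kl // => /eqP.
Qed.

Section SkewPower.

Variables (C : comUnitRingType) (q : C) (R : unitAlgType C) (M : nat).
Variables (kappa : {set 'I_M}) (x : 'I_M -> R) (P : pred 'I_M).
Variables (inv : bool) (B : R -> Prop) (z : R) (tau delta : R -> R) (s : int).

Local Notation A := (subalg kappa x P).
Hypothesis skew : skew_extension inv A B z tau delta.
Hypothesis cn1 : CN1_at q A tau delta s.
Hypothesis unit_q : q \is a GRing.unit.

(** Scalars commute with [z]; the expansion of [z * c] in powers of [z] being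
    unique, [tau] fixes [c] and [delta] kills it. *)
Lemma tau_scalar c : tau c%:A = c%:A.
Proof.
have Ac : A c%:A by constructor.
have A0 : A 0 by rewrite -(scale0r 1); constructor.
have Ad : A (tau c%:A - c%:A).
  constructor; first exact: (skew_tau_in skew).
  by rewrite -scaleNr; constructor.
(* z * c - c * z = 0, expanded in powers of z. *)
pose f (k : int) := if k == 1 then tau c%:A - c%:A else if k == 0 then delta c%:A else 0.
have Af k : A (f k) by rewrite /f; do 2!case: ifP => // _; apply: (skew_delta_in skew).
have := skew_unique skew (ks := [:: 1; 0]) (c := f) _ _ Af _ (mem_head _ _).
rewrite /f /= => /(_ isT) H; apply/eqP; rewrite -subr_eq0; apply/eqP; apply: H.
  by rewrite orbT.
rewrite big_cons big_seq1 /= expr1z expr0z mulr1 mulrBl addrAC -(skew_rel skew) //.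
by rewrite -scalerAl -scalerAr mulr1 mul1r subrr.
Qed.

Lemma tauZ c a : A a -> tau (c *: a) = c *: tau a.
Proof.
move=> Aa; rewrite -mulr_algl (skew_tauM skew) ?tau_scalar ?mulr_algl //.
by constructor.
Qed.

Lemma iter_tau_in n a : A a -> A (iter n tau a).
Proof. by move=> Aa; elim: n => //= n; apply: (skew_tau_in skew). Qed.

Lemma iter_delta_in n a : A a -> A (iter n delta a).
Proof. by move=> Aa; elim: n => //= n; apply: (skew_delta_in skew). Qed.

Lemma delta_tau n a : A a ->
  delta (iter n tau a) = (q ^ (- s)) ^+ n *: iter n tau (delta a).
Proof.
move=> Aa; elim: n => [|n IHn]; first by rewrite scale1r.
have [tau_delta _] := cn1; have An := iter_tau_in n Aa.
have uq : q ^ s \is a GRing.unit by rewrite unitrXz.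
have -> : delta (iter n.+1 tau a) = q ^ (- s) *: tau (delta (iter n tau a)).
  by rewrite tau_delta // scalerA -invr_expz mulVr // scale1r.
rewrite IHn tauZ ?scalerA ?exprS //.
exact/iter_tau_in/(skew_delta_in skew).
Qed.

(** The q-binomial theorem in a skew polynomial ring: [delta] and [tau]
    q-commute, so that the powers of [z] are moved across [a] as in the
    expansion of a power of a sum of two q-commuting operators. *)
Lemma skew_power n a : A a ->
  z ^+ n * a = \sum_(k < n.+1) qbin (q ^ (- s)) n k *:
    (iter (n - k) tau (iter k delta a) * z ^+ (n - k)).
Proof.
move=> Aa; pose T n k := iter (n - k) tau (iter k delta a) * z ^+ (n - k).
elim: n => [|n IHn]; first by rewrite big_ord1 /= qbin0 scale1r mulr1 mul1r.
rewrite exprS -mulrA IHn mulr_sumr.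
have step (k : 'I_n.+1) : z * (qbin (q ^ (- s)) n k *: T n k) =
    qbin (q ^ (- s)) n k *: T n.+1 k
    + ((q ^ (- s)) ^+ (n - k) * qbin (q ^ (- s)) n k) *: T n.+1 k.+1.
  have le_kn : (k <= n)%N by rewrite -ltnS.
  have Ak := iter_delta_in k Aa.
  rewrite -scalerAr /T mulrA (skew_rel skew); last exact: iter_tau_in.
  rewrite mulrDl scalerDr subSn // exprS -mulrA; congr (_ + _).
  rewrite delta_tau // -scalerAl scalerA subSS mulrC.
  by rewrite -iterS.
transitivity (\sum_(k < n.+1) (qbin (q ^ (- s)) n k *: T n.+1 k
    + ((q ^ (- s)) ^+ (n - k) * qbin (q ^ (- s)) n k) *: T n.+1 k.+1)).
  by apply: eq_bigr => k _; apply: step.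
rewrite big_split /= [RHS]big_ord_recl qbin0.
under [X in _ = _ + X]eq_bigr => k _ do rewrite lift0 qbinS scalerDl.
rewrite [X in _ = _ + X]big_split /= addrA; congr (_ + _).
rewrite [LHS]big_ord_recl /= qbin0 [X in _ = _ + X]big_ord_recr /=.
by rewrite (qbin_small _ (ltnSn n)) scale0r addr0.
Qed.

End SkewPower.

(** * Central powers at a root of unity *)

Lemma ground_ring_unit (K : fieldType) (C : comUnitRingType)
    (iota : {rmorphism {poly K} -> C}) : ground_ring iota -> iota 'X \is a GRing.unit.
Proof.
case=> fs [inv_S _ _]; have [|c Xc] := inv_S 'X.
  by have := mulsetM (mem_head 'X fs) (mulset1 ('X :: fs)); rewrite mulr1.
by apply/unitrP; exists c; rewrite mulrC Xc.
Qed.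

Lemma coprime_root_power (K : fieldType) l (eps : K) (s : int) k :
  l.-primitive_root eps -> coprimez l s -> (0 < k < l)%N -> (eps ^ (- s)) ^+ k != 1.
Proof.
move=> prim cop /andP[k0 lt_kl]; apply/negP; rewrite exprnP exprz_exp.
have eq1 m : (eps ^ m == 1) = (eps ^+ (absz m) == 1).
  by case: m => // m; rewrite NegzE -exprnN invr_eq1 abszN.
rewrite eq1 -(prim_order_dvd prim) abszM abszN Gauss_dvdr; last first.
  by move: cop; rewrite coprimezE.
by rewrite /= gtnNdvd.
Qed.

Section SpecialisedPowers.

Variables (K : fieldType) (C : comUnitRingType) (q : C) (R : unitAlgType C).
Variables (Re : algType K) (ev : {rmorphism C -> K}) (pi : {rmorphism R -> Re}).
Variables (eps : K) (l M : nat) (kappa : {set 'I_M}) (x : 'I_M -> R).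
Hypotheses (unit_q : q \is a GRing.unit) (ev_q : ev q = eps).
Hypothesis piZ : forall c a, pi (c *: a) = ev c *: pi a.
Hypothesis heps : l.-primitive_root eps.

Lemma ev_qX z : ev (q ^ z) = eps ^ z.
Proof. by rewrite rmorphXz // ev_q. Qed.

Lemma eps_power_order z : (eps ^ z) ^+ l = 1.
Proof.
by rewrite exprnP exprz_exp mulrC -exprz_exp -exprnP prim_expr_order // exp1rz.
Qed.

(** All the intermediate terms of the expansion of [z ^+ l * a] carry a
    q-binomial coefficient that vanishes at a root of unity of order [l], and
    the last one contains [iter l delta a = 0]. *)
Lemma power_commutes (P : pred 'I_M) inv B (z : R) tau delta s Nb a m :
  skew_extension inv (subalg kappa x P) B z tau delta ->
  CN1_at q (subalg kappa x P) tau delta s -> coprimez l s ->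
  subalg kappa x P a -> tau a = q ^ m *: a -> (Nb <= l)%N -> iter Nb delta a = 0 ->
  pi (z ^+ l) * pi a = pi a * pi (z ^+ l).
Proof.
move=> skew cn1 cop Aa tau_a le_Nl deltaN; have l0 := prim_order_gt0 heps.
have A0 : subalg kappa x P 0 by rewrite -(scale0r 1); constructor.
have delta0 : delta 0 = 0.
  by apply: (addrI (delta 0)); rewrite -(skew_deltaD skew) // !addr0.
have delta_l : iter l delta a = 0.
  rewrite -(subnK le_Nl) iterD deltaN.
  by elim: (l - Nb)%N => //= k ->.
have tau0 n : iter n tau 0 = 0.
  elim: n => //= n ->.
  by apply: (addrI (tau 0)); rewrite -(skew_tauD skew) // !addr0.
have tau_n n : iter n tau a = (q ^ m) ^+ n *: a.
  elim: n => [|n IHn]; first by rewrite scale1r.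
  by rewrite iterS IHn (tauZ skew) // tau_a scalerA exprSr.
rewrite -!rmorphM (skew_power skew cn1 unit_q) // big_ord_recl qbin0 scale1r subn0.
rewrite tau_n -scalerAl rmorphD piZ rmorphXn ev_qX eps_power_order scale1r.
rewrite rmorph_sum big1 ?addr0 // => k _.
rewrite lift0 piZ; have [lt_kl|le_lk] := ltnP k.+1 l.
  rewrite rmorph_qbin ev_qX qbin_root_of_unity ?scale0r //; last exact: eps_power_order.
  by move=> i; apply: coprime_root_power.
have -> : k.+1 = l by apply/eqP; rewrite eqn_leq le_lk ltn_ord.
by rewrite delta_l tau0 mul0r rmorph0 scaler0.
Qed.

Lemma commute_subalg (y : Re) :
  (forall j, y * pi (x j) = pi (x j) * y) -> (forall j, j \in kappa -> x j \is a GRing.unit) ->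
  forall a, subalg kappa x xpredT a -> y * pi a = pi a * y.
Proof.
move=> comm ux a; elim=> [c|j _|j _ jk|b c _ IHb _ IHc|b c _ IHb _ IHc] //.
- by rewrite piZ rmorph1 -scalerAr -scalerAl mulr1 mul1r.
- rewrite -[RHS]mulr1 -(rmorph1 pi) -(mulrV (ux j jk)) rmorphM !mulrA.
  by rewrite -[pi _ * y * _]mulrA comm !mulrA -rmorphM mulVr ?ux // rmorph1 mul1r.
- by rewrite rmorphD mulrDr mulrDl IHb IHc.
- by rewrite rmorphM mulrA IHb -!mulrA IHc.
Qed.

End SpecialisedPowers.

Section CentralPowers.

Variables (K : fieldType) (C : comUnitRingType) (q : C) (R : unitAlgType C).
Variables (Re : algType K) (ev : {rmorphism C -> K}) (pi : {rmorphism R -> Re}).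
Variables (eps : K) (l M : nat) (S : 'M[int]_M) (kappa : {set 'I_M}).
Variables (x : 'I_M -> R) (r : 'I_M -> 'I_M -> R).
Hypotheses (unit_q : q \is a GRing.unit) (ev_q : ev q = eps).
Hypothesis piZ : forall c a, pi (c *: a) = ev c *: pi a.
Hypothesis heps : l.-primitive_root eps.
Hypothesis hR : is_NQS q S kappa x r.
Variables (tau delta tau' delta' : 'I_M -> R -> R) (s s' : 'I_M -> int) (Nb : 'I_M -> nat).
Hypotheses (hleft : left_skew_data q S kappa x r tau delta).
Hypotheses (hright : right_skew_data q S kappa x tau' delta').
Hypotheses (hCN1 : CN1 q kappa x tau delta tau' delta' s s').
Hypotheses (hNb : nilpotency_bounds x delta delta' Nb).
Hypotheses (hl : admissible S kappa s s' Nb l).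

Lemma power_central i a : pi (x i ^+ l) * pi a = pi a * pi (x i ^+ l).
Proof.
have [_ cop le_max] := hl.
have le_N : (Nb i <= l)%N by apply: leq_trans le_max; apply: leq_bigmax.
have [cops cops'] := cop i; have [cnl cnr] := hCN1 i.
have [_ dN dN'] := hNb i.
apply: (commute_subalg piZ) (nqs_generated hR a); last exact: nqs_unit hR.
move=> j; have [lt_ij|lt_ji|/val_inj->] := ltngtP i j.
- have [skew tau_x _] := hleft i.
  apply: (power_commutes unit_q ev_q piZ heps skew cnl cops _ (tau_x j lt_ij) le_N (dN j lt_ij)).
  by constructor.
- have [skew tau_x] := hright i.
  apply: (power_commutes unit_q ev_q piZ heps skew cnr cops' _ (tau_x j lt_ji) le_N (dN' j lt_ji)).
  by constructor.
- by rewrite -!rmorphM -exprS -exprSr.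
Qed.

End CentralPowers.

(** * Monomial basis and weights of the specialised algebra *)

Section SpecialisedBasis.

Variables (K : fieldType) (C : comUnitRingType) (iota : {rmorphism {poly K} -> C}).
Variables (R : unitAlgType C) (Re : algType K) (eps : K).
Variables (ev : {rmorphism C -> K}) (pi : {rmorphism R -> Re}).
Variables (M : nat) (kappa : {set 'I_M}) (x : 'I_M -> R).
Hypothesis hev : forall p : {poly K}, ev (iota p) = p.[eps].
Hypothesis hRe : is_specialization iota eps ev pi.

(** The specialised algebra has no inversion of its own; the inverses of the
    images of the invertible variables come from the generic algebra. *)
Definition spec_power (k : 'I_M) (z : int) : Re := pi (x k ^ z).
Local Notation pw := spec_power.

Lemma pi_monomial t : pi (monomial x t) = mono pw t.
Proof. by rewrite /monomial rmorph_prod. Qed.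

Lemma span_spec (P : pred (expo M)) a : in_span x P a -> span pw P (pi a).
Proof.
have [_ piZ] := hRe; case=> ts [c [Pts ->]].
elim: ts Pts => [_|t ts IHts /= /andP[Pt Pts]].
  by rewrite big_nil rmorph0; apply: span0.
rewrite big_cons rmorphD piZ pi_monomial; apply: spanA => //.
exact: IHts.
Qed.

Hypothesis spanning : forall a, in_span x (admissible_expo kappa) a.
Hypothesis free : monomials_free kappa x.

Lemma spec_spanning a : span pw (admissible_expo kappa) a.
Proof. by have [[pi_onto _] _] := hRe; have [b <-] := pi_onto a; apply: span_spec. Qed.

(** A relation over the residue field lifts, with constant coefficients, to a
    combination of monomials that is divisible by [q - eps]; by freeness
    every one of its coefficients is, and so vanishes at [eps]. *)
Lemma spec_free (ts : seq (expo M)) (c : expo M -> K) :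
  uniq ts -> all (admissible_expo kappa) ts ->
  \sum_(t <- ts) c t *: mono pw t = 0 -> forall t, t \in ts -> c t = 0.
Proof.
move=> Uts Ats c0 t tts; have [[_ ker_pi] piZ] := hRe.
pose c' u := iota (c u)%:P.
have ev_c' u : ev (c' u) = c u by rewrite hev hornerC.
have [b] : exists b, \sum_(u <- ts) c' u *: monomial x u = iota ('X - eps%:P) *: b.
  apply/ker_pi; rewrite rmorph_sum -[RHS]c0; apply: eq_bigr => u _.
  by rewrite piZ ev_c' pi_monomial.
have [us [d [Aus ->]]] := spanning b.
(* The exponents in us may be repeated; multiplicities are collected on w. *)
pose w := undup (ts ++ us).
have Uw : uniq w by apply: undup_uniq.
have tsw : {subset ts <= w} by move=> u; rewrite mem_undup mem_cat => ->.
have usw : {subset us <= w} by move=> u; rewrite mem_undup mem_cat orbC => ->.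
have sum_w s (F : expo M -> R) : {subset s <= w} ->
    \sum_(u <- s) F u = \sum_(u <- w) F u *+ count_mem u s.
  move=> sw; elim: s sw => [|v s IHs] sw; first by rewrite big_nil big1.
  rewrite big_cons IHs => [|u us']; last by apply: sw; rewrite inE us' orbT.
  have vw : v \in w by apply: sw; rewrite mem_head.
  rewrite (bigD1_seq v) //= [RHS](bigD1_seq v) //= eqxx mulrS -addrA; congr (_ + (_ + _)).
  by apply: eq_bigr => u /negPf uv; rewrite eq_sym uv.
rewrite scaler_sumr (sum_w ts) // (sum_w us) // => /eqP; rewrite -subr_eq0 -sumrB.
pose f u := c' u *+ count_mem u ts - (iota ('X - eps%:P) * d u) *+ count_mem u us.
have -> : \sum_(u <- w) (c' u *: monomial x u *+ count_mem u ts
    - iota ('X - eps%:P) *: (d u *: monomial x u) *+ count_mem u us)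
    = \sum_(u <- w) f u *: monomial x u.
  by apply: eq_bigr => u _; rewrite scalerA scalerBl !scalerMnl.
move/eqP/(free Uw) => /(_ _ t)/=.
have Aw : all (admissible_expo kappa) w.
  apply/allP=> u; rewrite mem_undup mem_cat => /orP[/(allP Ats)|/(allP Aus)] //.
move=> /(_ Aw (tsw t tts)) /(congr1 ev).
rewrite /f rmorphB !rmorphMn rmorphM /= ev_c' hev !hornerE subrr mul0r mul0rn subr0 rmorph0.
by rewrite count_uniq_mem // tts.
Qed.

End SpecialisedBasis.

Section Weights.

Variables (M : nat) (kappa : {set 'I_M}) (V : nat).

(** These weights decrease so fast that a variable outside [kappa] outweighs all
    the monomials in later variables with exponents at most [V]; the variables
    in [kappa] have weight 0 because their exponents may be negative. *)
Definition geometric_weight (i : 'I_M) : nat :=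
  if i \in kappa then 0 else (V.+1 ^ (M - i))%N.

Lemma geometric_sum i : (i <= M)%N ->
  (\sum_(i <= k < M) V * V.+1 ^ (M - k) + V.+1 = V.+1 ^ (M - i).+1)%N.
Proof.
move=> le_iM; rewrite -(subKn le_iM); move: (M - i)%N (leq_subr i M) => d.
elim: d => [|d IHd] le_dM; first by rewrite subn0 big_geq // subnn.
rewrite big_ltn; last by rewrite ltn_subrL (leq_trans _ le_dM).
have -> : ((M - d.+1).+1 = M - d)%N by rewrite subnSK.
rewrite -addnA IHd ?(ltnW le_dM) // !subKn ?(ltnW le_dM) //.
by rewrite -mulSnr -expnS.
Qed.

Lemma wt_between (i j : 'I_M) t : i \notin kappa ->
  expo_between kappa i j t -> (forall k, t k <= V%:Z) ->
  below kappa geometric_weight (geometric_weight i + geometric_weight j)%N t.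
Proof.
move=> ik /andP[At btw] le_V; rewrite /below At /=.
suff : (wt geometric_weight t < geometric_weight i)%R.
  by move/lt_le_trans; apply; rewrite lez_nat leq_addr.
rewrite {2}/geometric_weight (negPf ik).
have lt_sum : (\sum_(i.+1 <= k < M) V * V.+1 ^ (M - k) < V.+1 ^ (M - i))%N.
  have := geometric_sum (ltn_ord i).
  have -> : (M - i.+1).+1 = (M - i)%N by rewrite subnSK.
  by lia.
apply: le_lt_trans (_ : _ <= (\sum_(i.+1 <= k < M) V * V.+1 ^ (M - k))%N%:Z) _;
  last by rewrite ltz_nat.
rewrite big_geq_mkord /= -natz natr_sum /wt /dot.
rewrite [X in _ <= X]big_mkcond /=; apply: ler_sum => k _; rewrite ffunE.
move/forallP/(_ k)/implyP: btw => btw.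
have tk := adm_ok k At; rewrite /geometric_weight.
have [->|tk0] := eqVneq (t k) 0; first by rewrite mulr0; case: ifP.
have /andP[lt_ik _] := btw tk0; rewrite lt_ik natz.
move: tk; rewrite /okexp; case: ifP => [kk _|_ /= tk]; first by rewrite mul0r.
by rewrite PoszM mulrC ler_wpM2r.
Qed.

End Weights.

(** * Structure of the specialised algebra *)

Section QCommute.

Variables (C : comUnitRingType) (R : unitAlgType C).

Definition qcommute (a b : R) := exists2 c : C, c \is a GRing.unit & a * b = c *: (b * a).

Lemma qcommute_sym a b : qcommute a b -> qcommute b a.
Proof.
by move=> [c uc ab]; exists c^-1; rewrite ?unitrV // ab scalerA mulVr // scale1r.
Qed.

Lemma qcommute1 a : qcommute a 1.
Proof. by exists 1; rewrite ?unitr1 // scale1r mulr1 mul1r. Qed.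

Lemma qcommuteM a b c : qcommute a b -> qcommute a c -> qcommute a (b * c).
Proof.
move=> [d ud ab] [e ue ac]; exists (d * e); rewrite ?unitrM ?ud //.
by rewrite mulrA ab -scalerAl -[b * a * c]mulrA ac -scalerAr scalerA mulrA.
Qed.

Lemma qcommuteV a b : b \is a GRing.unit -> qcommute a b -> qcommute a b^-1.
Proof.
move=> ub /qcommute_sym[c uc ba]; exists c => //.
have -> : a * b^-1 = b^-1 * (b * a) * b^-1 by rewrite mulKr.
by rewrite ba -scalerAr -scalerAl mulrA mulrK.
Qed.

Lemma qcommuteXz a b z : (b \is a GRing.unit) || (0 <= z) -> qcommute a b -> qcommute a (b ^ z).
Proof.
move=> uz ab; have qn n : qcommute a (b ^+ n).
  by elim: n => [|n IHn]; [apply: qcommute1 | rewrite exprS; apply: qcommuteM].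
case: z uz => [n _|n]; first exact: qn.
rewrite NegzE orbF -exprnN => ub.
by apply: qcommuteV; rewrite ?unitrX.
Qed.

End QCommute.

Section SpecialisedStructure.

Variables (K : fieldType) (C : comUnitRingType) (iota : {rmorphism {poly K} -> C}).
Variables (R : unitAlgType C) (Re : algType K) (eps : K).
Variables (ev : {rmorphism C -> K}) (pi : {rmorphism R -> Re}).
Variables (M : nat) (S : 'M[int]_M) (kappa : {set 'I_M}).
Variables (x : 'I_M -> R) (r : 'I_M -> 'I_M -> R).
Hypothesis unit_q : iota 'X \is a GRing.unit.
Hypothesis hR : is_NQS (iota 'X) S kappa x r.
Hypothesis hev : forall p : {poly K}, ev (iota p) = p.[eps].
Hypothesis hRe : is_specialization iota eps ev pi.

Local Notation pw := (spec_power pi x).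
Local Notation ok := (okexp kappa).

Lemma unit_qq i j : qq (iota 'X) S i j \is a GRing.unit.
Proof. by rewrite unitrXz. Qed.

Lemma unit_ok k z : ok k z -> (x k \is a GRing.unit) || (0 <= z).
Proof. by case/orP=> [/(nqs_unit hR)->//|->]; rewrite orbT. Qed.

Lemma spec_power0 k : pw k 0 = 1.
Proof. by rewrite /spec_power expr0z rmorph1. Qed.

Lemma spec_powerD k a b : ok k a -> ok k b -> pw k (a + b) = pw k a * pw k b.
Proof.
move=> /unit_ok ua /unit_ok ub; rewrite /spec_power -rmorphM; congr (pi _).
have [uk|nuk] := boolP (x k \is a GRing.unit); first exact: exprzDr.
by move: ua ub; rewrite (negPf nuk) /= => a0 b0; apply: exprzD_ss; rewrite a0 b0.
Qed.

Lemma spec_power_kappa k i z w : k \in kappa -> ok i w ->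
  exists2 c : K, c != 0 & pw k z * pw i w = c *: (pw i w * pw k z).
Proof.
move=> kk okw; have [_ piZ] := hRe.
have [c uc comm] : qcommute (x k ^ z) (x i ^ w).
  apply: qcommuteXz; first exact: unit_ok.
  apply/qcommute_sym/qcommuteXz; first by rewrite (nqs_unit hR).
  by exists (qq (iota 'X) S i k); [apply: unit_qq | apply: nqs_qcomm hR _ _ kk].
exists (ev c); last by rewrite /spec_power -!rmorphM comm piZ.
by rewrite -unitfE rmorph_unit.
Qed.

Lemma bounded_rest : exists V : nat, forall i j : 'I_M, (i < j)%N ->
  in_span x (fun t => expo_between kappa i j t && [forall k, t k <= V%:Z]) (r i j).
Proof.
have [f def_f] : {f : 'I_M * 'I_M -> seq (expo M) * (expo M -> C) &
    forall p : 'I_M * 'I_M, (p.1 < p.2)%N -> all (expo_between kappa p.1 p.2) (f p).1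
      /\ r p.1 p.2 = \sum_(t <- (f p).1) (f p).2 t *: monomial x t}.
  apply: (@choice _ _ (fun (p : 'I_M * 'I_M) g => (p.1 < p.2)%N ->
      all (expo_between kappa p.1 p.2) g.1
      /\ r p.1 p.2 = \sum_(t <- g.1) g.2 t *: monomial x t)) => -[i j] /=.
  have [lt_ij|ge_ij] := ltnP i j; last by exists ([::], fun=> 0).
  by have [ts [c [Pts def_r]]] := nqs_rest hR lt_ij; exists (ts, c).
exists (\sum_p \sum_(t <- (f p).1) \sum_k absz (t k))%N => i j lt_ij.
have [/= btw def_r] := def_f (i, j) lt_ij.
exists (f (i, j)).1, (f (i, j)).2; split=> //.
apply/allP=> t tts; rewrite (allP btw) //=; apply/forallP=> k.
apply: le_trans (_ : (absz (t k))%:Z <= _); first exact: lez_abs.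
rewrite lez_nat (bigD1 (i, j)) //= (perm_big _ (perm_to_rem tts)) big_cons (bigD1 k) //=.
by rewrite -!addnA leq_addr.
Qed.

Lemma spec_straightening : exists omega : 'I_M -> nat,
  [/\ forall k, k \in kappa -> omega k = 0%N,
      forall k, k \notin kappa -> (0 < omega k)%N
    & forall i k : 'I_M, i \notin kappa -> k \notin kappa -> (k < i)%N ->
      exists2 c : K, c != 0 &
        exists2 a, span pw (below kappa omega (omega k + omega i)%N) a
          & pw i 1 * pw k 1 = c *: (pw k 1 * pw i 1) + a].
Proof.
have [V rV] := bounded_rest; exists (geometric_weight kappa V); split.
- by move=> k kk; rewrite /geometric_weight kk.
- by move=> k kk; rewrite /geometric_weight (negPf kk) expn_gt0.
move=> i k ik kk lt_ki; have [_ piZ] := hRe.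
have evu : ev (qq (iota 'X) S k i) != 0 by rewrite -unitfE rmorph_unit // unit_qq.
exists (ev (qq (iota 'X) S k i))^-1; first by rewrite invr_eq0.
exists (- (ev (qq (iota 'X) S k i))^-1 *: pi (r k i)).
  apply: spanZ; have := span_spec hRe (rV k i lt_ki); apply: spanS => t /andP[btw /forallP le_V].
  exact: wt_between.
rewrite /spec_power !expr1z -!rmorphM (nqs_rel hR lt_ki) rmorphD piZ scalerDr scalerA.
by rewrite mulVf // scale1r scaleNr addrK.
Qed.

Lemma spec_leads : exists omega : 'I_M -> nat,
  (forall t, admissible_expo kappa t -> 0 <= wt omega t)
  /\ forall t u : expo M, admissible_expo kappa t -> admissible_expo kappa u ->
    leads kappa pw omega (t + u) (mono pw t * mono pw u).
Proof.
have [omega [omega0 omega_gt0 swap]] := spec_straightening.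
exists omega; split; first exact: wt_ge0.
move=> t u; apply: leads_mul => //; first exact: spec_power0.
  exact: spec_powerD.
exact: spec_power_kappa.
Qed.

Theorem spec_domain : noncomm_domain Re.
Proof.
have [omega [_ lead]] := spec_leads; apply: (leading_term_domain lead).
  exact: spec_spanning hRe (nqs_spanning hR).
exact: spec_free hev hRe (nqs_spanning hR) (nqs_free hR).
Qed.

Theorem spec_completely_closed : completely_closed Re.
Proof.
have [omega [wt0 lead]] := spec_leads; apply: (leading_term_completely_closed lead wt0).
  exact: spec_spanning hRe (nqs_spanning hR).
exact: spec_free hev hRe (nqs_spanning hR) (nqs_free hR).
Qed.

Lemma centralM (A : nzRingType) (a b : A) : central a -> central b -> central (a * b).
Proof. by move=> ca cb c; rewrite -mulrA cb !mulrA ca. Qed.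

(** The powers [x i ^+ l] are central, hence the monomials with exponents
    below [l] generate the algebra over its centre. *)
Lemma spec_finite l : (0 < l)%N -> (forall i a, pi (x i ^+ l) * a = a * pi (x i ^+ l)) ->
  exists N (v : 'I_N.+1 -> Re), forall a,
    exists2 c : 'I_N.+1 -> Re, (forall i, central (c i)) & a = \sum_i c i * v i.
Proof.
move=> l0 cent_l; pose T := {ffun 'I_M -> 'I_l}.
pose w (f : T) := mono pw [ffun k => (f k : nat)%:Z].
have cent_z k z : ok k z -> central (pw k (l%:Z * z)).
  move=> okz a; rewrite /spec_power; have [uk|nuk] := boolP (x k \is a GRing.unit).
    rewrite -exprz_exp; have ul : x k ^ l \is a GRing.unit by rewrite unitrXz.
    have cn n : pi ((x k ^ l) ^+ n) * a = a * pi ((x k ^ l) ^+ n).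
      rewrite rmorphXn /=; elim: n => [|n IHn]; first by rewrite mulr1 mul1r.
      by rewrite exprS -mulrA IHn mulrA cent_l -mulrA.
    case: z {okz} => n; first exact: cn.
    rewrite NegzE -exprnN; set y := _ ^+ _.
    have uy : y \is a GRing.unit by rewrite unitrX.
    rewrite -[LHS]mulr1 -(rmorph1 pi) -(mulrV uy) rmorphM !mulrA.
    by rewrite -[_ * a * pi y]mulrA -cn mulrA -rmorphM mulVr // rmorph1 mul1r.
  have := unit_ok okz; rewrite (negPf nuk) /=; case: z {okz} => // n _.
  rewrite -PoszM -exprnP exprM rmorphXn /=; elim: n => [|n IHn]; first by rewrite mulr1 mul1r.
  by rewrite exprS -mulrA IHn mulrA cent_l -mulrA.
pose good a := exists2 c : T -> Re, (forall f, central (c f)) & a = \sum_f c f * w f.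
have central0 : central (0 : Re) by move=> a; rewrite mulr0 mul0r.
have goodD a b : good a -> good b -> good (a + b).
  move=> [c cc ->] [d dd ->]; exists (fun f => c f + d f).
    by move=> f a'; rewrite mulrDl mulrDr cc dd.
  by rewrite -big_split; apply: eq_bigr => f _; rewrite mulrDl.
have good_mono c t : admissible_expo kappa t -> good (c *: mono pw t).
  move=> At; have mod_lt k : (absz (t k %% l)%Z < l)%N.
    by have := ltz_pmod (t k) (d := l); have := modz_ge0 (t k) (d := l); lia.
  (* Euclidean division of the exponents by l splits off a central factor. *)
  pose f : T := [ffun k => Ordinal (mod_lt k)].
  have def_t k : t k = l%:Z * (t k %/ l)%Z + (f k : nat)%:Z.
    rewrite ffunE /= {1}(divz_eq (t k) l) mulrC; congr (_ + _).
    by rewrite gez0_abs // modz_ge0 // gt_eqF.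
  have ok_div k : ok k (t k %/ l)%Z.
    have := adm_ok k At; rewrite /okexp; case: (k \in kappa) => //= tk.
    by rewrite divz_ge0.
  have ok_mul k : ok k (l%:Z * (t k %/ l)%Z).
    have := ok_div k; rewrite /okexp; case: (k \in kappa) => //= tk.
    exact: mulr_ge0.
  have [d cd def_m] : exists2 d, central d & mono pw t = d * w f.
    rewrite /w /mono; elim: (index_enum _) => [|k s [d cd IHs]].
      by exists 1; rewrite ?big_nil ?mulr1 // => a; rewrite mulr1 mul1r.
    exists (pw k (l%:Z * (t k %/ l)%Z) * d).
      by apply: centralM => //; apply: cent_z.
    rewrite !big_cons IHs {1}def_t spec_powerD //; last by rewrite /okexp orbT.
    have -> : [ffun k0 => (f k0 : nat)%:Z] k = (f k : nat)%:Z by rewrite [LHS]ffunE.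
    by rewrite -!mulrA; congr (_ * _); rewrite !mulrA cd.
  exists (fun g => if g == f then c *: d else 0).
    by move=> g; case: ifP => // _ a; rewrite -scalerAl -scalerAr cd.
  rewrite (bigD1 f) //= eqxx big1 ?addr0 ?def_m ?scalerAl // => g /negPf->.
  by rewrite mul0r.
have goodall a : good a.
  have := spec_spanning hRe (nqs_spanning hR) a.
  elim=> [|c t b At _ IHb]; last by apply: goodD => //; apply: good_mono.
  by exists (fun=> 0) => //; rewrite big1 // => f _; rewrite mul0r.
have cardT : #|T|.-1.+1 = #|T|.
  by rewrite prednK //; apply/card_gt0P; exists [ffun=> Ordinal l0].
exists #|T|.-1, (fun i => w (enum_val (cast_ord cardT i))) => a.
have [c cc ->] := goodall a; exists (fun i => c (enum_val (cast_ord cardT i))) => //.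
rewrite (reindex (fun i => enum_val (cast_ord cardT i))) //=.
exists (fun f => cast_ord (esym cardT) (enum_rank f)) => i _.
  by rewrite enum_valK cast_ordK.
by rewrite cast_ordKV enum_rankK.
Qed.

End SpecialisedStructure.

(** * Primitive idempotents and the quiver *)

Section PrimitiveIdempotents.

Variables (K : fieldType) (A : algType K) (N : nat) (v : 'I_N -> A).
Hypothesis span_v : forall a, exists c : 'I_N -> K, a = \sum_i c i *: v i.

Lemma annihilating_poly (p : A) : exists2 f : {poly K}, f != 0 & horner_alg p f = 0.
Proof.
have [c def_p] := choice (fun i : 'I_N.+1 => span_v (p ^+ i)).
pose B : 'M[K]_(N.+1, N) := \matrix_(i, k) c i k.
have : kermx B != 0.
  by rewrite -mxrank_eq0 mxrank_ker subn_eq0 -ltnNge ltnS rank_leq_col.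
case/rowV0Pn=> u /sub_kermxP uB u0.
exists (\poly_(i < N.+1) u 0 (inord i)).
  apply: contraNneq u0 => f0; apply/eqP/rowP=> i; rewrite mxE.
  by have := congr1 (fun f : {poly K} => f`_i) f0; rewrite coef_poly ltn_ord inord_val coef0.
rewrite poly_def raddf_sum /=.
transitivity (\sum_(i < N.+1) \sum_k (u 0 i * c i k) *: v k).
  apply: eq_bigr => i _; rewrite inord_val linearZ rmorphXn /= horner_algX def_p.
  by rewrite mulr_algl scaler_sumr; apply: eq_bigr => k _; rewrite scalerA.
rewrite exchange_big big1 // => k _; rewrite -scaler_suml.
have /rowP/(_ k) := uB; rewrite !mxE => uBk.
rewrite (_ : \sum_i _ = 0) ?scale0r // -[RHS]uBk.
by apply: eq_bigr => i _; rewrite mxE.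
Qed.

(** Fitting's lemma: the coprime factors ['X^(k.+1)] and [h] of a polynomial
    that kills [p] yield an idempotent of the corner ring of [e], which is 0 or
    [e]. *)
Lemma fitting (e p : A) : primitive_idempotent e -> e * p = p -> p * e = p ->
  (exists k, p ^+ k = 0) \/ (exists p', p * p' = e).
Proof.
move=> [ee e0 prim] ep pe; have [f f0 fp] := annihilating_poly p.
have [k [h h0 def_f]] := multiplicity_XsubC f 0; rewrite f0 /= in h0.
(* The additional factor 'X puts the idempotent into the corner ring even if
   0 is not a root of f. *)
rewrite subr0 in def_f; pose X := 'X^(k.+1) : {poly K}.
have XhP : horner_alg p (X * h) = 0.
  have -> : X * h = f * 'X by rewrite def_f /X exprSr [LHS]mulrC mulrA.
  by rewrite rmorphM /= fp mul0r.
have /Bezout_eq1_coprimepP[[u w] /= uw] : coprimep X h.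
  by rewrite coprimep_sym coprimep_expr // coprimepX.
pose E := horner_alg p (u * X).
have horner_comm (g1 g2 : {poly K}) :
    horner_alg p g1 * horner_alg p g2 = horner_alg p g2 * horner_alg p g1.
  by rewrite -!rmorphM mulrC.
have XE : horner_alg p X = p ^+ k.+1 by rewrite rmorphXn /= horner_algX.
have eE : e * E = E.
  by rewrite /E mulrC rmorphM /= XE exprS -!mulrA [e * _]mulrA ep.
have Ee : E * e = E.
  by rewrite /E rmorphM /= XE exprSr -!mulrA pe.
have EE : E * E = E.
  have : E * horner_alg p (w * h) = 0.
    by rewrite /E -rmorphM mulrACA rmorphM /= XhP mulr0.
  have -> : w * h = 1 - u * X by rewrite -uw addrC addKr.
  by rewrite rmorphB rmorph1 mulrBr mulr1 => /eqP; rewrite subr_eq0 => /eqP.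
have [|||||E0|eE0] := prim E (e - E);
  rewrite /Defs.idempotent ?mulrBl ?mulrBr ?EE ?eE ?Ee ?ee ?subrr ?subr0 //.
- by rewrite addrC subrK.
- left; exists k.+1; rewrite -XE -[LHS]mulr1 -(rmorph1 (horner_alg p)) -uw rmorphD mulrDr /=.
  rewrite -/E E0 mulr0 add0r -rmorphM mulrCA rmorphM /= XhP mulr0 //.
- right; exists (p ^+ k * horner_alg p u); rewrite mulrA -exprS -XE -rmorphM mulrC -/E.
  by apply/esym/eqP; rewrite -subr_eq0 eE0.
Qed.

(** The elements [1 - y * c] are invertible by the geometric series, so that a
    right ideal not containing [1] stays so when [y] is added. *)
Lemma nilpotent_radical (y : A) : (forall c, exists k, (y * c) ^+ k = 0) -> radical y.
Proof.
move=> nil I [[I0 ID IM] nI1 maxI]; apply: contrapT => nIy.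
pose J a := exists i c, I i /\ a = i + y * c.
have idJ : right_ideal J.
  split; first by exists 0, 0; rewrite mulr0 addr0.
    move=> _ _ [i [c [Ii ->]]] [i' [c' [Ii' ->]]].
    by exists (i + i'), (c + c'); rewrite mulrDr addrACA; split=> //; apply: ID.
  move=> _ b [i [c [Ii ->]]].
  by exists (i * b), (c * b); rewrite mulrDl mulrA; split=> //; apply: IM.
have [[i [c [Ii def1]]]|nJ1] := pselect (J 1).
  have [k nil_k] := nil c; apply: nI1.
  have -> : 1 = i * \sum_(m < k) (y * c) ^+ m.
    have -> : i = 1 - y * c by rewrite def1 addrK.
    by rewrite -(opprB _ 1) mulNr -subrX1 nil_k sub0r opprK.
  exact: IM.
apply: nIy; apply: (maxI J) => // [a Ia|]; first by exists a, 0; rewrite mulr0 addr0.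
by exists 0, 1; rewrite mulr1 add0r.
Qed.

(** The product [z * y] is a nonzero idempotent in the corner ring of the
    primitive idempotent [f], hence it is [f], and [y] and [z] are inverse to
    each other. *)
Lemma split_isomorphic (e f y z : A) : primitive_idempotent e -> primitive_idempotent f ->
  e * y = y -> f * z = z -> z * e = z -> y * f = y -> y * z = e ->
  right_isomorphic (right_multiples e) (right_multiples f).
Proof.
move=> [ee e0 _] [ff f0 primf] ey fz ze yf yz.
have zy : z * y = f.
  have zyzy : z * y * (z * y) = z * y by rewrite mulrA -[z * y * z]mulrA yz ze.
  have fzy : f * (z * y) = z * y by rewrite mulrA fz.
  have zyf : z * y * f = z * y by rewrite -mulrA yf.
  have [|||||zy0|] := primf (z * y) (f - z * y);
    rewrite /Defs.idempotent ?mulrBl ?mulrBr ?zyzy ?fzy ?zyf ?ff ?subrr ?subr0 //.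
  - by rewrite addrC subrK.
  - by case: e0; rewrite -ee -{1}yz -mulrA -yz [z * (y * z)]mulrA zy0 mul0r mulr0.
  - by move/eqP; rewrite subr_eq0 => /eqP.
exists ( *%R z); split=> [a b _ _|a b _|a [b ->]|_ _ [a ->] [b ->]|_ [b ->]].
- by rewrite mulrDr.
- by rewrite mulrA.
- by exists (z * (e * b)); rewrite [f * _]mulrA fz.
- by move/(congr1 ( *%R y)); rewrite !mulrA yz ee.
- by exists (y * b); [exists (y * b); rewrite mulrA ey | rewrite mulrA zy].
Qed.

(** By Fitting's lemma the elements [y * c * e] are either all nilpotent, and
    then [y] is in the radical, or one of them is invertible in the corner ring
    of [e], and then [y] is a split surjection from [f A] onto [e A]. *)
Lemma nonzero_hom_radical (e f y : A) : primitive_idempotent e -> primitive_idempotent f ->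
  e * y = y -> y * f = y ->
  ~ right_isomorphic (right_multiples e) (right_multiples f) -> radical y.
Proof.
move=> pe pf ey yf niso; have [ee _ _] := pe; have [ff _ _] := pf.
apply: nilpotent_radical => c.
have [||[k nil]|[p' inv]] := @fitting e (y * c * e) pe.
- by rewrite !mulrA ey.
- by rewrite -mulrA ee.
- exists k.+1; rewrite exprSr.
  have step m : (y * c) ^+ m * (y * c) = (y * c * e) ^+ m * (y * c).
    elim: m => [|m IHm]; first by rewrite !mul1r.
    rewrite !exprS -!mulrA -exprSr [in LHS]exprSr IHm !mulrA.
    have -> : y * c * e * (y * c * e) ^+ m * y * c = y * c * (e * ((y * c * e) ^+ m * y * c)).
      by rewrite !mulrA.
    have -> : e * ((y * c * e) ^+ m * y * c) = (y * c * e) ^+ m * y * c.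
      by case: m {IHm} => [|m]; rewrite ?mul1r ?exprS !mulrA ey.
    by rewrite !mulrA.
  by rewrite step nil mul0r.
- case: niso; apply: (@split_isomorphic e f y (f * (c * e * p' * e))) => //.
  + by rewrite mulrA ff.
  + by rewrite -!mulrA ee.
  + by rewrite mulrA yf !mulrA inv ee.
Qed.

End PrimitiveIdempotents.

Theorem theorem4p3 (K : closedFieldType) (charK : [pchar K] =i pred0)
  (C : comUnitRingType) (iota : {rmorphism {poly K} -> C})
  (hC : ground_ring iota)
  (R : unitAlgType C) (M : nat) (S : 'M[int]_M) (kappa : {set 'I_M})
  (x : 'I_M -> R) (r : 'I_M -> 'I_M -> R)
  (hR : is_NQS (iota 'X) S kappa x r)
  (tau delta tau' delta' : 'I_M -> R -> R)
  (hleft : left_skew_data (iota 'X) S kappa x r tau delta)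
  (hright : right_skew_data (iota 'X) S kappa x tau' delta')
  (s s' : 'I_M -> int)
  (hCN1 : CN1 (iota 'X) kappa x tau delta tau' delta' s s')
  (hCN2 : CN2 kappa x tau tau')
  (Nb : 'I_M -> nat) (hNb : nilpotency_bounds x delta delta' Nb)
  (l : nat) (hl : admissible S kappa s s' Nb l)
  (eps : K) (heps : l.-primitive_root eps)
  (ev : {rmorphism C -> K}) (hev : forall p : {poly K}, ev (iota p) = p.[eps])
  (Re : algType K) (pi : {rmorphism R -> Re})
  (hRe : is_specialization iota eps ev pi)
  (chi : Re -> K) (hchi : central_character chi)
  (Rechi : algType K) (rho : {lrmorphism Re -> Rechi})
  (hRechi : is_quotient rho (character_ideal chi))
  (n : nat) (e : 'I_n -> Rechi) (he : quiver_vertices e) :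
  (forall i j : 'I_n, i != j -> quiver_edge e i j /\ quiver_edge e j i)
  /\ quiver_connected e.
Proof.
have [prim_e _ iso_e _] := he.
have [[rho_onto ker_rho] [[pi_onto _] piZ]] := (hRechi, hRe).
have unit_q := ground_ring_unit hC.
have ev_q : ev (iota 'X) = eps by rewrite hev hornerX.
have l0 := prim_order_gt0 heps.
have cent_l i a : pi (x i ^+ l) * a = a * pi (x i ^+ l).
  have [b <-] := pi_onto a.
  exact: (power_central unit_q ev_q piZ heps hR hleft hright hCN1 hNb hl).
have [N [v span_v]] := spec_finite unit_q hR hRe l0 cent_l.
have dom := spec_domain unit_q hR hev hRe.
have closed := spec_completely_closed unit_q hR hev hRe.
have [chi1 chiD chiM chiZ] := hchi.
have central1 k : central (k%:A : Re).
  by move=> a; rewrite -scalerAl -scalerAr mul1r mulr1.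
have rho_central c : central c -> rho c = (chi c)%:A.
  move=> cc; have cN : central (- (chi c)%:A : Re).
    by rewrite -scaleNr; apply: central1.
  have : rho (c - (chi c)%:A) = 0.
    apply/ker_rho; exists 1%N, (fun=> c - (chi c)%:A), (fun=> 1).
    split; last by rewrite big_ord1 mulr1.
    move=> _; split; first by move=> a; rewrite mulrBl mulrBr cc (central1 _ a).
    by rewrite chiD // -scaleNr chiZ ?chi1 ?mulr1 ?subrr // => a; rewrite mul1r mulr1.
  by rewrite rmorphB /= linearZ /= rmorph1 => /eqP; rewrite subr_eq0 => /eqP.
(* The centre acts on the fibre by scalars, so the fibre is finite
   dimensional. *)
have span_rho a : exists c : 'I_N.+1 -> K, a = \sum_i c i *: rho (v i).
  have [b <-] := rho_onto a; have [c cc ->] := span_v b.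
  exists (fun i => chi (c i)); rewrite rmorph_sum; apply: eq_bigr => i _.
  by rewrite rmorphM /= (rho_central _ (cc i)) mulr_algl.
have edge i j : i != j -> quiver_edge e i j.
  move=> ij; have [ei_idem ei0 _] := prim_e i; have [ej_idem ej0 _] := prim_e j.
  have [c eice] : exists c, e i * c * e j <> 0.
    apply: contrapT => nex.
    have [[a def_a] [b def_b]] := (rho_onto (e i), rho_onto (e j)).
    have [] := fiber_idempotents_linked (a := a) (b := b) charK dom closed span_v hchi.
    - by apply/ker_rho; rewrite rmorphB rmorphM def_a ei_idem subrr.
    - by apply/ker_rho; rewrite rmorphB rmorphM def_b ej_idem subrr.
    - move=> c; apply/ker_rho; rewrite !rmorphM def_a def_b.
      by apply: contrapT => ne; apply: nex; exists (rho c).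
    - by move/ker_rho; rewrite def_a.
    - by move/ker_rho; rewrite def_b.
  have idem_y : e i * (e i * c * e j) * e j = e i * c * e j.
    by rewrite !mulrA ei_idem -mulrA ej_idem.
  exists (e i * c * e j); last by rewrite idem_y.
  apply: (nonzero_hom_radical span_rho (prim_e i) (prim_e j)).
  - by rewrite !mulrA ei_idem.
  - by rewrite -[_ * e j * e j]mulrA ej_idem.
  - by move/iso_e/eqP; rewrite (negPf ij).
split=> [i j ij|i j]; first by split; apply: edge => //; rewrite eq_sym.
have [->|/edge eij] := eqVneq i j; first exact: rst_refl.
exact: rst_step.
Qed.
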